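(* Let $G=G_0$ be a sphere and let $G_{n+1}$ be the Barycentric refinement of $G_n$ for $n\ge0$. (a) Suppose $G$ is a $2r$-sphere, and let $B$ be the linear Barycentric refinement operator satisfying $Bf(G_n)=f(G_{n+1})$ for the $f$-vectors. Then $B$ is upper triangular with eigenvalues $k!$, $k=1,\dots,2r$. If $g=(g_0,\dots,g_{2r})$ is the eigenvector of the largest eigenvalue $r!$, then $\lim_{n\to\infty}A(G_n)=g_{2r}/g_0$. (b) If $G$ is an odd-dimensional sphere, then $\lim_{n\to\infty}A(G_n)=\infty$.
   Context: Let $G=(V,E)$ be a finite simple graph. A $k$-simplex of $G$ is (the vertex set of) a complete subgraph $K_{k+1}$; $f_k$ is the number of $k$-simplices, $m$ is the maximal dimension of a simplex, and $f(G)=(f_0,\dots,f_m)$ is the $f$-vector. Order the vertices; for a $(k+1)$-simplex $x=\{v_0<\dots<v_{k+1}\}$ and $y=x\setminus\{v_i\}$ put $\mathrm{sign}(y,x)=(-1)^i$. The exterior derivative $d_k$ is the $f_{k+1}\times f_k$ matrix given by $d_kf(x)=\sum_{y\subset x,\ \dim y=k}\mathrm{sign}(y,x)f(y)$ (with $d_{-1}=0$, $d_m=0$). The $k$-form Laplacian is $L_k=d_k^*d_k+d_{k-1}d_{k-1}^*$. The pseudo determinant $\mathrm{Det}(M)$ of a square matrix $M$ is the product of its non-zero eigenvalues, counted with multiplicity (equal to $1$ if there are none). The squared analytic torsion is $A(G)=\prod_{k=0}^m\mathrm{Det}(L_k)^{k(-1)^{k+1}}$. The Barycentric refinement of $G$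 is the graph whose vertices are the simplices of $G$, two distinct simplices being adjacent if one is contained in the other. The linear Barycentric refinement operator $B$ is the linear map on vectors $(f_0,\dots,f_{2r})$ that sends the $f$-vector of a graph to the $f$-vector of its Barycentric refinement. The unit sphere $S(v)$ of a vertex $v$ is the subgraph induced by the neighbors of $v$; $G-v$ is the subgraph induced by $V\setminus\{v\}$. Contractible graphs are defined inductively: the one-point graph $K_1$ is contractible, and $G$ is contractible if there is a vertex $v$ such that both $S(v)$ and $G-v$ are contractible. Spheres are defined inductively: the empty graph is the $(-1)$-sphere, and for $k\ge0$ a $k$-sphere is a graph all of whose unit spheres are $(k-1)$-spheres and such that $G-v$ is contractible for some vertex $v$.
   Formalization: In (a) the eigenvalues are k! for k=1,…,2r+1, the largest is (2r+1)!, and the limit is g_0/g_{2r}; as printed this fails for the octahedron (eigenvalues 1,2,6; g=(1,3,2); limit 1/2, not 2). In (b) the empty (-1)-sphere, where A=1 always, is excluded. *)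

(* Defs.v *)
From HB Require Import structures.
From mathcomp Require Import all_boot all_order all_algebra.
From mathcomp Require Import all_classical all_reals all_analysis.
From mathcomp Require Import complex.

Set Implicit Arguments.
Unset Strict Implicit.
Unset Printing Implicit Defensive.

Import Order.TTheory GRing.Theory Num.Theory.
Import numFieldNormedType.Exports.

Local Open Scope ring_scope.

Record sgraph := SGraph {
  vertex :> finType;
  adj : rel vertex;
  adj_sym : symmetric adj;
  adj_irrefl : irreflexive adj }.

Section Induced.
Variables (G : sgraph) (S : {set G}).

Definition induced_adj : rel {x : G | x \in S} :=
  fun x y => adj (val x) (val y).

Lemma induced_sym : symmetric induced_adj.
Proof. by move=> x y; apply: adj_sym. Qed.

Lemma induced_irrefl : irreflexive induced_adj.
Proof. by move=> x; apply: adj_irrefl. Qed.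

Definition induced : sgraph := SGraph induced_sym induced_irrefl.
End Induced.

Definition unit_sphere (G : sgraph) (v : G) : sgraph :=
  induced [set w | adj v w].

Definition remove_vertex (G : sgraph) (v : G) : sgraph :=
  induced [set~ v].

Inductive contractible : sgraph -> Prop :=
| contractible_K1 (G : sgraph) : #|G| = 1%N -> contractible G
| contractible_step (G : sgraph) (v : G) :
    contractible (unit_sphere v) -> contractible (remove_vertex v) ->
    contractible G.

(* The dimension is shifted by one, so that the recursion starts at the
   (-1)-sphere: [sphere_succ n G] says that G is an (n - 1)-sphere. *)
Fixpoint sphere_succ (n : nat) (G : sgraph) : Prop :=
  if n is n'.+1 then
    (forall v : G, sphere_succ n' (unit_sphere v)) /\
    (exists v : G, contractible (remove_vertex v))
  else #|G| = 0%N.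

Definition graph_sphere (k : nat) (G : sgraph) : Prop := sphere_succ k.+1 G.

Definition clique (G : sgraph) (s : {set G}) : bool :=
  [forall x in s, forall y in s, (x != y) ==> adj x y].

Definition simplices (G : sgraph) (k : nat) : {set {set G}} :=
  [set s | clique s & #|s| == k.+1].

(* One more than the maximal dimension of a simplex (0 for the empty graph). *)
Definition clique_number (G : sgraph) : nat :=
  \max_(s : {set G} | clique s) #|s|.

(* The vector (f_0, ..., f_(d-1)). *)
Definition fvector (R : pzSemiRingType) (d : nat) (G : sgraph) : 'cV[R]_d :=
  \col_(k < d) #|simplices G k|%:R.

Section Barycentric.
Variable G : sgraph.

Definition bary_vertex : finType := {s : {set G} | clique s && (s != finset.set0)}.

Definition bary_adj : rel bary_vertex :=
  fun s t => (s != t) && ((val s \subset val t) || (val t \subset val s)).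

Lemma bary_sym : symmetric bary_adj.
Proof. by move=> s t; rewrite /bary_adj eq_sym orbC. Qed.

Lemma bary_irrefl : irreflexive bary_adj.
Proof. by move=> s; rewrite /bary_adj eqxx. Qed.

Definition barycentric : sgraph := SGraph bary_sym bary_irrefl.
End Barycentric.

Definition barycentric_iter (n : nat) (G : sgraph) : sgraph :=
  iter n barycentric G.

(* The dimension bound makes the length-d vectors the whole f-vectors. *)
Definition barycentric_operator (R : pzSemiRingType) (d : nat) (B : 'M[R]_d) : Prop :=
  forall H : sgraph, (clique_number H <= d)%N ->
    B *m fvector R d H = fvector R d (barycentric H).

Definition linear_order (T : Type) (le : rel T) : Prop :=
  [/\ reflexive le, antisymmetric le, transitive le & total le].

Section Torsion.
Variables (R : realType) (G : sgraph) (le : rel G).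

(* The index of v in x, when x is listed in increasing order from 0. *)
Definition position (x : {set G}) (v : G) : nat :=
  #|[set w in x | (w != v) && le w v]|.

(* sign(y, x) if y is a facet of x, and 0 otherwise: at most one vertex v
   contributes to the sum. *)
Definition incidence (y x : {set G}) : R :=
  \sum_(v in x | y == x :\ v) (-1) ^+ position x v.

Definition ext_deriv (k : nat) :
    'M[R]_(#|simplices G k.+1|, #|simplices G k|) :=
  \matrix_(i, j) incidence (enum_val j) (enum_val i).

Definition form_laplacian (k : nat) : 'M[R]_#|simplices G k| :=
  (ext_deriv k)^T *m ext_deriv k +
  (if k is k'.+1 return 'M[R]_#|simplices G k|
   then ext_deriv k' *m (ext_deriv k')^T else 0).

(* The complex eigenvalues, listed with algebraic multiplicity. *)
Definition spectrum (n : nat) (M : 'M[R]_n) : seq R[i] :=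
  sval (closed_field_poly_normal (char_poly (map_mx (real_complex R) M))).

(* The product is real, since the non-real eigenvalues of a real matrix come
   in conjugate pairs. *)
Definition pseudo_det (n : nat) (M : 'M[R]_n) : R :=
  complex.Re (\prod_(z <- spectrum M | z != 0) z).

Definition squared_torsion : R :=
  \prod_(k < clique_number G)
    pseudo_det (form_laplacian k) ^ (k%:Z * (-1) ^+ k.+1).
End Torsion.

(* Main.v *)
(* By Hodge theory Det(L_k) = D_k D_(k-1) with D_k = Det(d_k^* d_k), so that
   A(G) telescopes to the alternating product of the D_k.  If the cochain complex
   is exact over the integers except for the fundamental class, D_k is the product
   of the squared covolumes of the row and column lattices of d_k, and a saturated
   lattice has the same covolume as its orthogonal complement; hence
   A(G) = f_0 |z|^(+-2), where z is the fundamental cycle.  For a sphere all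
   coefficients of z are 1 or -1, and A(G) is f_0 / f_2r or f_0 f_(2r+1).
   A contractible unit sphere and a contractible rest make a graph acyclic by
   pushing cycles off a vertex, and the vanishing of homology and the
   unimodularity of z are both inherited by the Barycentric refinement.  Finally
   f_i(G_1) counts chains of simplices, which makes B triangular, and the
   f-vectors of the G_n align with its dominant eigenvector. *)
From HB Require Import structures.
Require Import Defs.
From mathcomp Require Import all_boot all_order all_algebra.
From mathcomp Require Import zify ring lra.

Set Implicit Arguments.
Unset Strict Implicit.
Unset Printing Implicit Defensive.

Import Order.TTheory GRing.Theory Num.Theory.

(** * Contractible sets and spheres inside a fixed graph *)

(** The vertex orders on the graphs G_n are unrelated, so no orientation can be carried along a
    refinement. Unimodularity is therefore expressed without signs, by comparing absolute values of
    top coefficients across faces of codimension one. Nor are the G_n shown to be spheres; what is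
    propagated is the dimension, one good link in each dimension, and unimodularity. The homological
    half yields a generating cycle z whose coefficients might be large; the other half makes all |z
    x| equal, and a generator is indivisible, so the common value is 1 and |z|^2 counts the top
    simplices. The factor f_0 comes from the empty simplex: the boundary into degree -1 is a column
    of ones, with Gram determinant f_0. Exactness over the integers, rather than over a field, is
    what makes the lattices saturated. A vector (f_0, ..., f_2r) has 2r+1 entries, so the diagonal
    of B is 1!, ..., (2r+1)! and the dominant eigenvalue is (2r+1)!; since A = f_0 / f_2r, the limit
    is g_0 / g_2r. *)

Definition nbhd (G : sgraph) (v : G) : {set G} := [set w | adj v w].

(** Iterated induced subgraphs have nested subtypes as vertex types; subsets of one ambient graph
    avoid them, the unit sphere of v in S being [S :&: nbhd v]. *)
Inductive contractible_set (G : sgraph) : {set G} -> Prop :=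
| contractible_set1 (v : G) : contractible_set [set v]
| contractible_setS (S : {set G}) (v : G) :
    v \in S -> contractible_set (S :&: nbhd v) -> contractible_set (S :\ v) ->
    contractible_set S.

Fixpoint sphere_set (n : nat) (G : sgraph) (S : {set G}) : Prop :=
  if n is n'.+1 then
    (forall v, v \in S -> sphere_set n' (S :&: nbhd v)) /\
    (exists2 v, v \in S & contractible_set (S :\ v))
  else S = set0.

(* The link of one well-chosen vertex determines the homology; unlike [sphere_set],
   this survives Barycentric refinement without a study of all links. *)
Fixpoint weak_sphere (n : nat) (G : sgraph) (S : {set G}) : Prop :=
  if n is n'.+1 then
    exists v, [/\ v \in S, weak_sphere n' (S :&: nbhd v)
                & contractible_set (S :\ v)]
  else S = set0.

Lemma in_nbhd (G : sgraph) (v w : G) : (w \in nbhd v) = adj v w.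
Proof. by rewrite inE. Qed.

Lemma imset_nbhd (G H : sgraph) (f : G -> H) (S : {set G}) v :
  {in S &, injective f} -> {in S &, forall x y, adj (f x) (f y) = adj x y} ->
  v \in S -> f @: (S :&: nbhd v) = f @: S :&: nbhd (f v).
Proof.
move=> fI fA vS; apply/setP=> y; apply/imsetP/setIP => [[x]|[]].
  by rewrite inE in_nbhd => /andP[xS vx] ->; rewrite in_nbhd fA // imset_f.
case/imsetP=> x xS ->; rewrite in_nbhd fA // => vx.
by exists x => //; rewrite inE xS in_nbhd.
Qed.

Lemma imset_setD1 (T T' : finType) (f : T -> T') (S : {set T}) v :
  {in S &, injective f} -> v \in S -> f @: (S :\ v) = f @: S :\ f v.
Proof.
move=> fI vS; apply/setP=> y; apply/imsetP/setD1P => [[x]|[nyv]].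
  case/setD1P=> nxv xS ->; split; last exact: imset_f.
  by apply: contraNneq nxv => /fI ->.
case/imsetP=> x xS yE; exists x => //; rewrite !inE xS andbT.
by apply: contraNneq nyv => <-; rewrite yE.
Qed.

(** The hypotheses are confined to S because [cone_bary], to which this is applied, is controlled
    only on the refinement of a link. *)
Lemma contractible_set_imset (G H : sgraph) (f : G -> H) (S : {set G}) :
  {in S &, injective f} -> {in S &, forall x y, adj (f x) (f y) = adj x y} ->
  contractible_set S -> contractible_set (f @: S).
Proof.
move=> fI fA Sc; elim: Sc fI fA => {S} [v|S v vS _ IH1 _ IH2] fI fA.
  by rewrite imset_set1; apply: contractible_set1.
have sub1 : {subset S :&: nbhd v <= S} by move=> x /setIP[].
have sub2 : {subset S :\ v <= S} by move=> x /setD1P[].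
apply: (@contractible_setS _ _ (f v)); first exact: imset_f.
- rewrite -imset_nbhd //; apply: IH1; first exact: sub_in2 fI.
  by move=> x y /sub1 xS /sub1 yS; apply: fA.
- rewrite -imset_setD1 //; apply: IH2; first exact: sub_in2 fI.
  by move=> x y /sub2 xS /sub2 yS; apply: fA.
Qed.

Lemma weak_sphere_imset n (G H : sgraph) (f : G -> H) (S : {set G}) :
  {in S &, injective f} -> {in S &, forall x y, adj (f x) (f y) = adj x y} ->
  weak_sphere n S -> weak_sphere n (f @: S).
Proof.
elim: n S => [|n IH] S fI fA /=; first by move=> ->; rewrite imset0.
case=> v [vS vW vC]; exists (f v).
have sub1 : {subset S :&: nbhd v <= S} by move=> x /setIP[].
have sub2 : {subset S :\ v <= S} by move=> x /setD1P[].
split; first exact: imset_f.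
- rewrite -imset_nbhd //; apply: IH vW; first exact: sub_in2 fI.
  by move=> x y /sub1 xS /sub1 yS; apply: fA.
- rewrite -imset_setD1 //; apply: contractible_set_imset vC.
    exact: sub_in2 fI.
  by move=> x y /sub2 xS /sub2 yS; apply: fA.
Qed.

Lemma imset_induced (G H : sgraph) (S : {set H}) (f : H -> G) :
  [set f (val x) | x in [set: induced S]] = f @: S.
Proof.
apply/setP=> y; apply/imsetP/imsetP => [[x _ ->]|[x xS ->]].
  by exists (val x) => //; apply: valP.
by exists (exist _ x xS).
Qed.

(** All embeddings f are quantified over, since the induction replaces f by its composite with the
    inclusion of an induced subgraph. *)
Lemma contractible_imset (H : sgraph) : contractible H ->
  forall (G : sgraph) (f : H -> G), injective f ->
    (forall x y, adj (f x) (f y) = adj x y) -> contractible_set (f @: setT).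
Proof.
elim=> {H} [H H1|H v _ IH1 _ IH2] G f fI fA.
  have /cards1P[v HE] : #|[set: H]| == 1 by rewrite cardsT H1.
  by rewrite HE imset_set1; apply: contractible_set1.
have fIi : {in [set: H] &, injective f} by move=> x y _ _; apply: fI.
have fAi : {in [set: H] &, forall x y, adj (f x) (f y) = adj x y}.
  by move=> x y _ _; apply: fA.
apply: (@contractible_setS _ _ (f v)); first exact: imset_f.
- rewrite -imset_nbhd ?inE // setTI /nbhd -imset_induced.
  apply: (IH1 _ (f \o val)) => [x y /fI/val_inj //|x y].
  by rewrite /= fA.
- rewrite -imset_setD1 ?inE // setTD -imset_induced.
  apply: (IH2 _ (f \o val)) => [x y /fI/val_inj //|x y].
  by rewrite /= fA.
Qed.

Lemma sphere_succ_imset n (H : sgraph) : sphere_succ n H ->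
  forall (G : sgraph) (f : H -> G), injective f ->
    (forall x y, adj (f x) (f y) = adj x y) -> sphere_set n (f @: setT).
Proof.
elim: n H => [|n IH] H /=.
  by move=> H0 G f _ _; rewrite (cards0_eq (A := [set: H])) ?cardsT // imset0.
case=> Hv [v vC] G f fI fA.
have fIi : {in [set: H] &, injective f} by move=> x y _ _; apply: fI.
have fAi : {in [set: H] &, forall x y, adj (f x) (f y) = adj x y}.
  by move=> x y _ _; apply: fA.
split=> [w /imsetP[x _ ->]|]; last first.
  exists (f v); first exact: imset_f.
  rewrite -imset_setD1 ?inE // setTD -imset_induced.
  apply: (contractible_imset vC (f := f \o val)) => [x y /fI/val_inj //|x y].
  by rewrite /= fA.
rewrite -imset_nbhd ?inE // setTI /nbhd -imset_induced.
apply: (IH _ (Hv x) _ (f \o val)) => [y z /fI/val_inj //|y z].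
by rewrite /= fA.
Qed.

Lemma sphere_succ_set n (G : sgraph) : sphere_succ n G -> sphere_set n [set: G].
Proof.
move=> Gs; rewrite -[setT]imset_id.
exact: (sphere_succ_imset Gs (f := id)).
Qed.

Lemma contractible_set_neq0 (G : sgraph) (S : {set G}) :
  contractible_set S -> exists v, v \in S.
Proof. by case=> [v|{}S v vS _ _]; exists v; rewrite ?inE. Qed.

Lemma sphere_set_neq0 n (G : sgraph) (S : {set G}) :
  sphere_set n.+1 S -> exists v, v \in S.
Proof. by case=> _ [v vS _]; exists v. Qed.

Lemma sphere_set_weak n (G : sgraph) (S : {set G}) :
  sphere_set n S -> weak_sphere n S.
Proof.
elim: n S => [|n IH] S //= [Sv [v vS vC]].
by exists v; split=> //; apply/IH/Sv.
Qed.

(** The base vertices are removed one at a time: the link of such a vertex and the rest both remain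
    cones with apex a. *)
Lemma contractible_set_cone (G : sgraph) (S : {set G}) (a : G) :
  a \in S -> (forall x, x \in S -> x != a -> adj a x) -> contractible_set S.
Proof.
have [n] := ubnP #|S|; elim: n S => // n IH S leSn aS aA.
have [/eqP|[u uS]] := set_0Vmem (S :\ a).
  rewrite setD_eq0 => Sa; suff -> : S = [set a] by apply: contractible_set1.
  by apply/eqP; rewrite eqEsubset Sa sub1set.
case/setD1P: uS => nua uS; have au := aA u uS nua.
have ltSu : #|S :\ u| < n by rewrite -ltnS (leq_trans _ leSn) // [in leqRHS](cardsD1 u) uS.
apply: (@contractible_setS _ _ u) => //; apply: IH.
- apply: leq_ltn_trans ltSu; apply/subset_leq_card/subsetP=> x.
  by rewrite !inE => /andP[-> ux]; rewrite andbT; apply: contraTneq ux => ->; rewrite adj_irrefl.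
- by rewrite !inE aS adj_sym.
- by move=> x /setIP[xS _]; apply: aA.
- by [].
- by rewrite !inE eq_sym nua.
- by move=> x /setD1P[_ xS]; apply: aA.
Qed.

Lemma cliqueP (G : sgraph) (s : {set G}) :
  reflect {in s &, forall x y, x != y -> adj x y} (clique s).
Proof.
apply: (iffP 'forall_in_'forall_in_implyP) => sC x.
  by move=> y xs ys; apply: sC.
by move=> xs y ys; apply: sC.
Qed.

Lemma clique_subset (G : sgraph) (s t : {set G}) :
  s \subset t -> clique t -> clique s.
Proof.
move=> /subsetP st /cliqueP tC; apply/cliqueP=> x y /st xt /st yt.
exact: tC.
Qed.

Lemma clique_setU1 (G : sgraph) (v : G) (s : {set G}) : v \notin s ->
  clique (v |: s) = clique s && (s \subset nbhd v).
Proof.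
move=> vs; apply/idP/andP => [vC|[sC /subsetP sv]].
  split; first exact: clique_subset (subsetUr _ _) vC.
  apply/subsetP=> x xs; rewrite in_nbhd; apply: (cliqueP _ vC).
  - by rewrite !inE eqxx.
  - by rewrite !inE xs orbT.
  - by apply: contraNneq vs => ->.
apply/cliqueP=> x y /setU1P[->|xs] /setU1P[->|ys]; first by rewrite eqxx.
- by move=> _; rewrite -in_nbhd sv.
- by move=> _; rewrite adj_sym -in_nbhd sv.
- exact: (cliqueP _ sC).
Qed.

Lemma clique0 (G : sgraph) : clique (set0 : {set G}).
Proof. by apply/cliqueP=> x; rewrite inE. Qed.

Lemma clique1 (G : sgraph) (v : G) : clique [set v].
Proof. by apply/cliqueP=> x y /set1P-> /set1P->; rewrite eqxx. Qed.

(** * Barycentric refinement *)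

Section BarycentricSets.
Variable G : sgraph.
Implicit Types (S : {set G}) (v : G) (s t : barycentric G).

Definition bary_set (S : {set G}) : {set barycentric G} :=
  [set s : barycentric G | val s \subset S].

Lemma bary_vertex1_proof (v : G) : clique [set v] && ([set v] != set0).
Proof. by rewrite clique1; apply/set0Pn; exists v; rewrite inE. Qed.

Definition bary_vertex1 (v : G) : barycentric G :=
  exist _ [set v] (bary_vertex1_proof v).

Lemma bary_clique s : clique (val s).
Proof. by case/andP: (valP s). Qed.

Lemma bary_neq0 s : val s != set0.
Proof. by case/andP: (valP s). Qed.

Lemma adj_bary s t :
  adj s t = (s != t) && ((val s \subset val t) || (val t \subset val s)).
Proof. by []. Qed.

Lemma in_bary_set S s : (s \in bary_set S) = (val s \subset S).
Proof. by rewrite inE. Qed.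

(** Where v |: s is no simplex the value falls back to {v}; the map serves only for s in the link of
    v. *)
Definition cone_bary (v : G) (s : barycentric G) : barycentric G :=
  insubd (bary_vertex1 v) (v |: val s).

Lemma val_cone_bary S v s :
  s \in bary_set (S :&: nbhd v) -> val (cone_bary v s) = v |: val s.
Proof.
rewrite in_bary_set subsetI => /andP[_ sv].
rewrite val_insubd clique_setU1; last first.
  by apply/negP=> /(subsetP sv); rewrite in_nbhd adj_irrefl.
rewrite bary_clique sv /= ifT //.
by apply/set0Pn; exists v; rewrite setU11.
Qed.

Lemma notin_link S v s : s \in bary_set (S :&: nbhd v) -> v \notin val s.
Proof.
rewrite in_bary_set subsetI => /andP[_ sv].
by apply/negP=> /(subsetP sv); rewrite in_nbhd adj_irrefl.
Qed.

Lemma bary_vertex1_adj v s :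
  adj (bary_vertex1 v) s = (v \in val s) && (s != bary_vertex1 v).
Proof.
rewrite adj_bary eq_sym andbC /= sub1set; case: (v \in val s) => //=.
rewrite subset1 (negbTE (bary_neq0 s)) orbF -val_eqE /=.
by rewrite andbN.
Qed.

(** Only larger simplices are comparable with {v}, and they are the v |: t with t a simplex of the
    link. At {v} the link is thus a refined link; at a larger simplex it would be a join. *)
Lemma bary_set_link S v : v \in S ->
  bary_set S :&: nbhd (bary_vertex1 v) =
  cone_bary v @: bary_set (S :&: nbhd v).
Proof.
move=> vS; apply/setP=> s; rewrite inE in_nbhd in_bary_set bary_vertex1_adj.
apply/idP/imsetP => [/and3P[sS vs nsv]|[t tS ->]]; last first.
  have vt := notin_link tS.
  rewrite -val_eqE /= (val_cone_bary tS) setU11 /=.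
  move: tS; rewrite in_bary_set subsetI => /andP[tS _].
  rewrite subUset sub1set vS tS /=.
  apply: contraNneq (bary_neq0 t) => tv; apply/eqP/setP=> x; rewrite inE.
  apply: contraNF vt => xt; suff /eqP <- : x == v by [].
  by rewrite -in_set1 -tv !inE xt orbT.
have tP : clique (val s :\ v) && (val s :\ v != set0).
  rewrite (clique_subset (subsetDl _ _) (bary_clique s)) setD_eq0 subset1.
  by rewrite (negbTE (bary_neq0 s)) orbF.
have sE : val s = v |: (val s :\ v) by rewrite setD1K.
have tS : (exist _ (val s :\ v) tP : barycentric G) \in bary_set (S :&: nbhd v).
  rewrite in_bary_set /= subsetI (subset_trans (subsetDl _ _) sS) /=.
  have := bary_clique s; rewrite {1}sE clique_setU1 ?setD11 //.
  by case/andP.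
exists (exist _ (val s :\ v) tP) => //.
by apply: val_inj; rewrite (val_cone_bary tS).
Qed.

Lemma cone_bary_inj S v :
  {in bary_set (S :&: nbhd v) &, injective (cone_bary v)}.
Proof.
move=> s t sS tS /(congr1 val); rewrite !(val_cone_bary sS, val_cone_bary tS).
move=> /(congr1 (fun A => A :\ v)); rewrite !setU1K ?(notin_link sS) ?(notin_link tS) //.
exact: val_inj.
Qed.

Lemma setU1_subset v (s t : {set G}) : v \notin s -> v \notin t ->
  (v |: s \subset v |: t) = (s \subset t).
Proof.
move=> vs vt; apply/idP/idP; last exact: setUS.
by move=> /(setSD [set v]); rewrite !setU1K.
Qed.

Lemma cone_bary_adj S v :
  {in bary_set (S :&: nbhd v) &, forall s t,
    adj (cone_bary v s) (cone_bary v t) = adj s t}.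
Proof.
move=> s t sS tS; rewrite !adj_bary (inj_in_eq (@cone_bary_inj S v)) //.
rewrite (val_cone_bary sS) (val_cone_bary tS).
by rewrite !setU1_subset ?(notin_link sS) ?(notin_link tS).
Qed.

(* The simplices through v other than {v} are removed by increasing dimension:
   at its turn, the unit sphere of s is a cone with apex s \ v. *)
Lemma contractible_bary_add S v (A : {set barycentric G}) :
  v \in S -> contractible_set (bary_set (S :\ v)) ->
  (forall s, s \in A -> [/\ val s \subset S, v \in val s & s != bary_vertex1 v]) ->
  (forall s t, s \in A -> val s \subset val t -> val t \subset S -> t \in A) ->
  contractible_set (bary_set (S :\ v) :|: A).
Proof.
move=> vS SvC; have [n] := ubnP #|A|; elim: n A => // n IH A leAn AS Aup.
have [->|[s0 s0A]] := set_0Vmem A; first by rewrite setU0.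
pose s := [arg min_(s < s0 in A) #|val s|].
have [sA smin] : s \in A /\ forall t, t \in A -> #|val s| <= #|val t|.
  by rewrite /s; case: arg_minnP => // s1 s1A s1min.
have [sS vs nsv] := AS s sA.
have tP : clique (val s :\ v) && (val s :\ v != set0).
  rewrite (clique_subset (subsetDl _ _) (bary_clique s)) setD_eq0 subset1.
  by rewrite (negbTE (bary_neq0 s)) orbF -val_eqE in nsv *.
pose a : barycentric G := exist _ (val s :\ v) tP.
have proper_as : val a != val s.
  by apply: contraTneq vs => <-; rewrite /= setD11.
apply: (@contractible_setS _ _ s); first by rewrite inE sA orbT.
- apply: (@contractible_set_cone _ _ a).
    rewrite !inE adj_bary eq_sym -val_eqE proper_as /=.
    by rewrite subsetDl orbT andbT setSD.
  move=> x /setIP[]; rewrite in_nbhd adj_bary => xSA /andP[nsx xs] nxa.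
  rewrite adj_bary eq_sym nxa /=.
  (* A neighbour in A contains s by minimality, hence contains s :\ v; a neighbour in
     [bary_set (S :\ v)] omits v, hence lies inside s :\ v. *)
  have [xA|xA] := boolP (x \in A).
    have [_ vx _] := AS x xA; have := smin x xA => sx.
    have {}xs : val s \subset val x.
      case/orP: xs => // xs; move: nsx; rewrite -val_eqE eq_sym => /negbTE nsx.
      by move/subset_leq_card: (xs); rewrite leqNgt ltn_neqAle sx andbT
           => /negbNE/eqP cE; have := eqEcard (val x) (val s);
         rewrite xs nsx cE leqnn.
    by rewrite (subset_trans (subsetDl _ _) xs).
  move: xSA; rewrite inE (negbTE xA) orbF in_bary_set subsetD1 => /andP[_ vx].
  case/orP: xs => xs; first by rewrite (subsetP xs) in vx.
  by rewrite subsetD1 xs vx orbT.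
- have -> : (bary_set (S :\ v) :|: A) :\ s = bary_set (S :\ v) :|: (A :\ s).
    apply/setP=> x; rewrite !inE; case: eqVneq => //= ->.
    by rewrite subsetD1 vs andbF.
  apply: IH.
  + by move: leAn; rewrite (cardsD1 s) sA.
  + by move=> t /setD1P[_]; apply: AS.
  + move=> t u /setD1P[nts tA] tu uS; rewrite !inE (Aup t u) // andbT.
    apply: contraNneq nts => us; rewrite us in tu.
    by rewrite -val_eqE eqEcard tu smin.
Qed.

Lemma contractible_bary_setD1 S v : v \in S ->
  contractible_set (bary_set (S :\ v)) ->
  contractible_set (bary_set S :\ bary_vertex1 v).
Proof.
move=> vS SvC.
pose A := [set s : barycentric G |
  [&& val s \subset S, v \in val s & s != bary_vertex1 v]].
have -> : bary_set S :\ bary_vertex1 v = bary_set (S :\ v) :|: A.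
  apply/setP=> s; rewrite !inE subsetD1; case: (val s \subset S); rewrite ?andbF //=.
  case: (boolP (v \in val s)) => /= vs; rewrite ?andbT ?andbF ?orbF //.
  by apply: contraNneq vs => ->; rewrite inE.
apply: (@contractible_bary_add S v A) => // [s|s t]; rewrite !inE; first by case/and3P.
case/and3P=> sS vs nsv st tS; rewrite tS (subsetP st) //=.
apply: contraNneq nsv => tv; move: st; rewrite tv subset1 (negbTE (bary_neq0 s)).
by rewrite orbF -val_eqE.
Qed.

Lemma contractible_bary_set S : contractible_set S -> contractible_set (bary_set S).
Proof.
elim=> {S} [v|S v vS _ IH1 _ IH2].
  suff -> : bary_set [set v] = [set bary_vertex1 v] by apply: contractible_set1.
  apply/setP=> s; rewrite !inE subset1 (negbTE (bary_neq0 s)) orbF.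
  by rewrite -val_eqE.
apply: (@contractible_setS _ _ (bary_vertex1 v)).
- by rewrite inE sub1set.
- rewrite bary_set_link //; apply: contractible_set_imset IH1.
    exact: cone_bary_inj.
  exact: cone_bary_adj.
- exact: contractible_bary_setD1.
Qed.

Lemma weak_sphere_bary_set n S : weak_sphere n S -> weak_sphere n (bary_set S).
Proof.
elim: n S => [|n IH] S /=.
  move=> ->; apply/setP=> s; rewrite !inE subset0; exact/negbTE/bary_neq0.
case=> v [vS vW vC]; exists (bary_vertex1 v); split.
- by rewrite inE sub1set.
- rewrite bary_set_link //; apply: weak_sphere_imset (IH _ vW).
    exact: cone_bary_inj.
  exact: cone_bary_adj.
- exact/contractible_bary_setD1/contractible_bary_set.
Qed.

Lemma weak_sphere_barycentric n :
  weak_sphere n [set: G] -> weak_sphere n [set: barycentric G].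
Proof.
move=> /weak_sphere_bary_set; congr weak_sphere.
by apply/setP=> s; rewrite !inE subsetT.
Qed.
End BarycentricSets.

(** * The f-vector of the Barycentric refinement *)

(** The number of chains of i+1 nonempty sets with a fixed s-element top. It equals the number of
    surjections from an s-set onto an (i+1)-set, (i+1)! times a Stirling number of the second
    kind. *)
Fixpoint chain_count (i s : nat) : nat :=
  if i is i'.+1 then \sum_(t < s) 'C(s, t) * chain_count i' t else (0 < s).

Lemma chain_count_small i s : s <= i -> chain_count i s = 0.
Proof.
elim: i s => [|i IH] s /=; first by rewrite leqn0 => /eqP->.
by move=> si; rewrite big1 // => t _; rewrite IH ?muln0 // -ltnS (leq_trans (ltn_ord t)).
Qed.

Lemma chain_count_diag i : chain_count i i.+1 = i.+1`!.
Proof.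
elim: i => [|i IH] //=; rewrite big_ord_recr /= IH big1 ?add0n => [|t _].
  by rewrite binSn factS.
by rewrite chain_count_small ?muln0 // -ltnS ltn_ord.
Qed.

Lemma sum_by_card (T : finType) (P : pred {set T}) (F : nat -> nat) n :
  (forall s, P s -> #|s| < n) ->
  \sum_(s | P s) F #|s| = \sum_(k < n) #|[set s | P s & #|s| == k]| * F k.
Proof.
move=> Pn.
transitivity (\sum_(k < n) \sum_(s | P s && (#|s| == k)) F k).
  rewrite (exchange_big_dep P) /= => [|k s _ /andP[] //].
  apply: eq_bigr => s Ps; rewrite (bigD1 (Ordinal (Pn s Ps))) ?Ps ?eqxx //=.
  rewrite big1 ?addn0 // => k; rewrite ?Ps /= => /andP[/eqP sk /eqP[]].
  exact: val_inj.
by apply: eq_bigr => k _; rewrite -sum_nat_const; apply: eq_bigl => s; rewrite inE.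
Qed.

Section BarycentricCount.
Variable G : sgraph.
Implicit Types (C : {set barycentric G}) (s t : barycentric G).

Definition chain_top C t := (t \in C) && [forall s in C, val s \subset val t].

Lemma chain_top_unique C : clique C -> C != set0 -> \sum_t chain_top C t = 1.
Proof.
move=> CC /set0Pn[s0 s0C].
pose t := [arg max_(s > s0 in C) #|val s|].
have [tC tmax] : t \in C /\ forall s, s \in C -> #|val s| <= #|val t|.
  by rewrite /t; case: arg_maxnP => // s1 s1A s1max.
have tT : chain_top C t.
  rewrite /chain_top tC; apply/forall_inP=> s sC.
  have [->//|st] := eqVneq s t; have := cliqueP _ CC s t sC tC st.
  rewrite adj_bary st /= => /orP[//|ts].
  suff /eqP -> : val t == val s by [].
  by rewrite eqEcard ts tmax.
rewrite (bigD1 t) //= tT big1 // => s st; apply/eqP; rewrite eqb0.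
apply: contra st => /andP[sC /forall_inP sT].
have /andP[_ /forall_inP tT'] := tT.
by rewrite -val_eqE eqEsubset tT' // sT.
Qed.

Lemma card_by_top (X : {set {set barycentric G}}) :
  (forall C, C \in X -> clique C /\ C != set0) ->
  #|X| = \sum_t #|[set C in X | chain_top C t]|.
Proof.
move=> XC; rewrite -sum1_card.
under eq_bigr => C CX do rewrite -(chain_top_unique (XC C CX).1 (XC C CX).2).
rewrite exchange_big; apply: eq_bigr => t _.
by rewrite -big_mkcondr -sum1_card; apply: eq_bigl => C; rewrite inE.
Qed.

Definition chains_to (i : nat) (t : barycentric G) : {set {set barycentric G}} :=
  [set C : {set barycentric G} | [&& clique C, #|C| == i.+1 & chain_top C t]].

Lemma card_simplices_bary i :
  #|simplices (barycentric G) i| = \sum_t #|chains_to i t|.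
Proof.
rewrite card_by_top => [|C]; last first.
  by rewrite inE => /andP[-> /eqP Ci]; rewrite -card_gt0 Ci.
by apply: eq_bigr => t _; apply: eq_card => C; rewrite !inE -andbA.
Qed.

Lemma card_chains_to0 t : #|chains_to 0 t| = 1.
Proof.
rewrite (_ : chains_to 0 t = [set [set t]]) ?cards1 //.
apply/setP=> C; rewrite !inE; apply/and3P/eqP => [[_ /cards1P[s ->]]|->].
  by rewrite /chain_top inE => /andP[/eqP-> _].
rewrite clique1 cards1 /chain_top set11; split=> //.
by apply/forall_inP=> s /set1P->.
Qed.

(** Deleting t leaves a nonempty chain strictly below t, which is counted by its own top s. *)
Lemma card_chains_toS i t :
  #|chains_to i.+1 t| = \sum_(s : barycentric G | val s \proper val t) #|chains_to i s|.
Proof.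
pose Y := [set C : {set barycentric G} | [&& clique C, #|C| == i.+1
  & [forall s in C, val s \proper val t]]].
have tY C : C \in Y -> t \notin C.
  rewrite inE => /and3P[_ _ /forall_inP CP]; apply/negP=> /CP.
  by rewrite properE subxx andbF.
have XE : chains_to i.+1 t = [set t |: C | C in Y].
  apply/setP=> C; apply/idP/imsetP => [|[D DY ->]].
    rewrite inE => /and3P[CC Ci /andP[tC /forall_inP CT]].
    exists (C :\ t); last by rewrite setD1K.
    rewrite inE (clique_subset (subsetDl _ _) CC); move: Ci.
    rewrite (cardsD1 t) tC add1n eqSS => -> /=.
    apply/forall_inP=> s /setD1P[st sC].
    by rewrite properEneq CT // andbT val_eqE.
  have tD := tY D DY; move: DY; rewrite inE => /and3P[DC Di /forall_inP DP].
  rewrite inE clique_setU1 // DC cardsU1 tD (eqP Di) eqxx /=; apply/andP; split.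
    apply/subsetP=> s sD; rewrite inE adj_bary orbC proper_sub ?DP // andbT.
    by apply: contraNneq tD => ->.
  rewrite /chain_top setU11; apply/forall_inP=> s /setU1P[->//|sD].
  exact/proper_sub/DP.
rewrite XE card_in_imset; last first.
  by move=> C D CY DY /(congr1 (fun A => A :\ t)); rewrite !setU1K ?tY.
rewrite card_by_top => [|C]; last first.
  by rewrite inE => /and3P[-> /eqP Ci _]; rewrite -card_gt0 Ci.
rewrite [RHS]big_mkcond; apply: eq_bigr => s _; case: ifPn => st.
  apply: eq_card => C; rewrite !inE -!andbA; congr [&& _, _ & _].
  case: (boolP (chain_top C s)); rewrite ?andbF // andbT => /andP[_ /forall_inP CT].
  by apply/forall_inP=> u uC; apply: sub_proper_trans (CT u uC) st.
apply: eq_card0 => C; rewrite !inE; apply/negP=> /andP[/and3P[_ _ /forall_inP CP]].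
by case/andP=> sC _; rewrite CP in st.
Qed.

Lemma sum_bary_vertex (P : pred {set G}) (F : {set G} -> nat) :
  \sum_(t : barycentric G | P (val t)) F (val t) =
  \sum_(s : {set G} | [&& P s, clique s & s != set0]) F s.
Proof.
rewrite [RHS](reindex_omap (val : barycentric G -> _) insub) /= => [|s /and3P[_ sC s0]].
  apply: eq_bigl => t; rewrite valK eqxx andbT.
  by rewrite bary_clique bary_neq0 !andbT.
by rewrite insubT ?sC ?s0.
Qed.

(** Only the size of t matters, because every nonempty subset of a simplex is a simplex. *)
Lemma card_chains_to i t : #|chains_to i t| = chain_count i #|val t|.
Proof.
elim: i t => [|i IH] t.
  by rewrite card_chains_to0 /= card_gt0 bary_neq0.
rewrite card_chains_toS /=; under eq_bigr do rewrite IH.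
rewrite (sum_bary_vertex (fun s : {set G} => s \proper val t) (fun s : {set G} => chain_count i #|s|)).
transitivity (\sum_(s : {set G} | s \proper val t) chain_count i #|s|).
  rewrite [RHS](bigID (fun s : {set G} => s != set0)) /= [X in _ = _ + X]big1 ?addn0.
    apply: eq_bigl => s; case: (boolP (s \proper val t)) => //= st.
    by rewrite (clique_subset (proper_sub st) (bary_clique t)).
  by move=> s /andP[_ /negPn/eqP->]; rewrite cards0 chain_count_small.
rewrite (@sum_by_card _ _ (chain_count i) #|val t|) => [|s]; last exact: proper_card.
apply: eq_bigr => k _; congr (_ * _); rewrite -cards_draws; apply: eq_card => s.
rewrite !inE properEcard -andbA; case: eqP => [->|_]; last by rewrite !andbF.
by rewrite ltn_ord.
Qed.

Lemma leq_clique_number (s : {set G}) : clique s -> #|s| <= clique_number G.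
Proof. by move=> sC; apply: (leq_bigmax_cond (F := fun s : {set G} => #|s|)). Qed.

Lemma card_simplices_barycentric i n : clique_number G <= n ->
  #|simplices (barycentric G) i| =
  \sum_(j < n) chain_count i j.+1 * #|simplices G j|.
Proof.
move=> Gn; rewrite card_simplices_bary; under eq_bigr do rewrite card_chains_to.
rewrite (sum_bary_vertex predT (fun s : {set G} => chain_count i #|s|)) /=.
rewrite (@sum_by_card _ _ (chain_count i) n.+1) => [|s /andP[sC _]]; last first.
  by rewrite ltnS (leq_trans (leq_clique_number sC)).
(* The empty set has size 0 and tops no chain; dropping its term turns sizes into dimensions. *)
rewrite big_ord_recl (@chain_count_small i (@ord0 n)) // muln0 add0n.
apply: eq_bigr => k _; rewrite mulnC; congr (_ * _); apply: eq_card => s.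
rewrite !inE -andbA; congr (_ && _); rewrite lift0.
by rewrite -card_gt0; case: (#|s| =P k.+1) => [->|_]; rewrite ?andbF.
Qed.

Lemma simplices_gt0 i : (0 < #|simplices G i|) = (i < clique_number G).
Proof.
apply/card_gt0P/idP => [[s]|iG].
  by rewrite inE => /andP[sC /eqP <-]; apply: leq_clique_number.
have [|s sC sE] := @eq_bigmax_cond _ (@clique G) (fun s : {set G} => #|s|).
  by apply/card_gt0P; exists set0; apply: clique0.
have {}sE : clique_number G = #|s| by exact: sE.
rewrite sE in iG; have : 0 < #|[set t : {set G} | t \subset s & #|t| == i.+1]|.
  by rewrite cards_draws bin_gt0.
case/card_gt0P=> t; rewrite inE => /andP[ts ti]; exists t.
by rewrite inE ti (clique_subset ts sC).
Qed.
End BarycentricCount.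

Lemma clique_number_leq (G : sgraph) n :
  (forall i, n <= i -> #|simplices G i| = 0) -> clique_number G <= n.
Proof. by move=> Gn; rewrite leqNgt -simplices_gt0 Gn. Qed.

Lemma clique_number_barycentric (G : sgraph) :
  clique_number (barycentric G) = clique_number G.
Proof.
apply/eqP; rewrite eqn_leq; apply/andP; split.
  apply: clique_number_leq => i Gi; rewrite (card_simplices_barycentric _ (leqnn _)).
  rewrite big1 // => j _; rewrite chain_count_small ?mul0n //.
  exact: leq_trans (ltn_ord j) Gi.
case cE: (clique_number G) => [//|n]; rewrite -simplices_gt0.
rewrite (@card_simplices_barycentric _ _ n.+1) ?cE // big_ord_recr /=.
by rewrite addn_gt0 muln_gt0 chain_count_diag fact_gt0 simplices_gt0 cE leqnn orbT.
Qed.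

(** * Simplicial homology *)

Local Open Scope ring_scope.

Section Chains.
Variables (G : sgraph) (le : rel G).
Hypothesis leL : linear_order le.
Implicit Types (S x y : {set G}) (u v : G).

(* Chains are ungraded functions on vertex sets; the empty simplex is included, so
   that homology is reduced. *)
Local Notation chain := {ffun {set G} -> int}.
Implicit Types (f g b z : chain).

Definition sgn (v : G) (x : {set G}) : int := (-1) ^+ position le x v.

Lemma sgnK v x (a : int) : sgn v x * (sgn v x * a) = a.
Proof. by rewrite mulrA -expr2 sqrr_sign mul1r. Qed.

Lemma position_setU1 u v x : u \notin x ->
  position le (u |: x) v = ((u != v) && le u v + position le x v)%N.
Proof.
move=> ux; rewrite /position.
have [uv|uv] := boolP ((u != v) && le u v); last first.
  rewrite add0n; apply: eq_card => w; rewrite !inE.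
  by case: (eqVneq w u) => // ->; rewrite (negbTE uv) !andbF.
transitivity #|u |: [set w in x | (w != v) && le w v]|.
  by apply: eq_card => w; rewrite !inE; case: (eqVneq w u) => // ->; rewrite uv.
by rewrite cardsU1 inE (negbTE ux).
Qed.

Lemma sgn_setU1 v x : sgn v (v |: x) = sgn v x.
Proof.
have [vx|vx] := boolP (v \in x); first by rewrite (setUidPr _) ?sub1set.
by rewrite /sgn position_setU1 // eqxx.
Qed.

Lemma sgn_setD1 v x : sgn v (x :\ v) = sgn v x.
Proof.
have [vx|vx] := boolP (v \in x); first by rewrite -sgn_setU1 setD1K.
by congr sgn; apply/setP=> w; rewrite !inE; case: eqVneq => // ->; rewrite (negbTE vx).
Qed.

(** Exactly one of u and v precedes the other, and inserting it first shifts the position of the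
    other by one. *)
Lemma sgn_anticomm u v x : u != v -> u \notin x -> v \notin x ->
  sgn u x * sgn v (u |: x) = - (sgn v x * sgn u (v |: x)).
Proof.
case: leL => leR leA leT leO uv ux vx.
rewrite /sgn !position_setU1 // !exprD uv [v == u]eq_sym uv /=.
have := leO u v; have := leA u v.
case: (le u v); case: (le v u) => //= uvE _; rewrite ?expr1 ?expr0; try ring.
by rewrite uvE ?eqxx in uv.
Qed.

(** The transpose of the exterior derivative: the coefficient at y collects all v |: y. At the empty
    set it is the augmentation, up to no sign. *)
Definition boundary f : chain :=
  [ffun y : {set G} => \sum_(v | v \notin y) sgn v y * f (v |: y)].

(** The part of f on the simplices through v, with v deleted. It anticommutes with the boundary and
    determines f together with the values off v, which takes the place of a long exact sequence. *)
Definition link v f : chain :=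
  [ffun y : {set G} => if v \in y then 0 else sgn v y * f (v |: y)].

Definition cone v b : chain :=
  [ffun x : {set G} => if v \in x then sgn v x * b (x :\ v) else 0].

Definition supported S f := forall x, f x != 0 -> clique x && (x \subset S).

Definition avoids v f := forall x, v \in x -> f x = 0.

Lemma boundaryB f g : boundary (f - g) = boundary f - boundary g.
Proof.
apply/ffunP=> y; rewrite !ffunE -sumrB; apply: eq_bigr => v _.
by rewrite !ffunE mulrBr.
Qed.

HB.instance Definition _ := GRing.isZmodMorphism.Build chain chain boundary boundaryB.

Lemma linkB v f g : link v (f - g) = link v f - link v g.
Proof.
apply/ffunP=> y; rewrite !ffunE; case: ifP => _; first by rewrite subr0.
by rewrite mulrBr.
Qed.

HB.instance Definition _ v :=
  GRing.isZmodMorphism.Build chain chain (link v) (linkB v).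

Lemma link_boundary v f : link v (boundary f) = - boundary (link v f).
Proof.
apply/ffunP=> y; rewrite !ffunE; case: ifPn => vy.
  by rewrite big1 ?oppr0 // => u _; rewrite !ffunE setU1r // mulr0.
rewrite mulr_sumr [in RHS](bigD1 v) //=.
have -> : link v f (v |: y) = 0 by rewrite ffunE setU11.
rewrite mulr0 add0r.
rewrite -sumrN; apply: eq_big => [u|u uvy]; first by rewrite !inE negb_or andbC.
have uv : v != u by apply: contraNneq uvy => ->; rewrite setU11.
have uy : u \notin y by apply: contraNN uvy; apply: setU1r.
rewrite !ffunE !inE (negbTE uv) (negbTE vy) /= !mulrA sgn_anticomm //.
by rewrite mulNr setUCA.
Qed.

Lemma link_cone v b : avoids v b -> link v (cone v b) = b.
Proof.
move=> bv; apply/ffunP=> y; rewrite !ffunE; case: ifPn => vy; first by rewrite bv.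
by rewrite setU11 setU1K // sgn_setU1 sgnK.
Qed.

Lemma linkE v f x : v \in x -> f x = sgn v x * link v f (x :\ v).
Proof. by move=> vx; rewrite ffunE setD11 setD1K // sgn_setD1 sgnK. Qed.

Lemma eq_link v f g :
  link v f = link v g -> (forall y, v \notin y -> f y = g y) -> f = g.
Proof.
move=> fg fgv; apply/ffunP=> x; have [vx|/fgv//] := boolP (v \in x).
by rewrite (linkE f vx) fg -linkE.
Qed.

Lemma avoids_boundary v b : avoids v b -> avoids v (boundary b).
Proof.
by move=> bv x vx; rewrite ffunE big1 // => u _; rewrite bv ?mulr0 ?setU1r.
Qed.

Lemma avoids_link0 v f : avoids v f -> link v f = 0.
Proof.
move=> fv; apply/ffunP=> y; rewrite !ffunE; case: ifP => // _.
by rewrite fv ?mulr0 // setU11.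
Qed.

Lemma boundary_cone v b :
  avoids v b -> boundary (cone v b) = b - cone v (boundary b).
Proof.
move=> bv; apply: (eq_link (v := v)) => [|y vy].
  rewrite link_boundary link_cone // raddfB /= link_cone; last exact: avoids_boundary.
  by rewrite avoids_link0 // sub0r.
rewrite !ffunE (negbTE vy) subr0 (bigD1 v) //= big1 ?addr0 => [|u /andP[uy uv]].
  by rewrite ffunE setU11 setU1K // sgn_setU1 sgnK.
by rewrite ffunE !inE eq_sym (negbTE uv) (negbTE vy) mulr0.
Qed.

Lemma boundary_boundary f : boundary (boundary f) = 0.
Proof.
apply/ffunP=> y; rewrite !ffunE.
pose F u v := sgn u y * (sgn v (u |: y) * f (v |: (u |: y))).
pose P u v := [&& u != v, u \notin y & v \notin y].
have -> : \sum_(u | u \notin y) sgn u y * boundary f (u |: y) =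
          \sum_u \sum_(v | P u v) F u v.
  rewrite big_mkcond; apply: eq_bigr => u _; case: ifPn => uy.
    rewrite ffunE mulr_sumr; apply: eq_bigl => v.
    by rewrite !inE negb_or /P uy eq_sym.
  by rewrite big1 // => v /and3P[_]; rewrite (negbTE uy).
(* Exchanging the order of the two insertions negates the double sum, and the integers have no
   2-torsion. *)
set X := LHS; suff XN : X = - X.
  by apply/eqP; rewrite -[_ == _](mulrn_eq0 X 2) mulr2n {1}XN addNr.
rewrite {1}/X (exchange_big_dep predT) //= /X -sumrN; apply: eq_bigr => u _.
rewrite -sumrN; apply: eq_big => [v|v /and3P[vu vy uy]].
  by rewrite /P eq_sym [X in _ && X]andbC.
by rewrite /F !mulrA sgn_anticomm // mulNr setUCA.
Qed.

Lemma supported_link S v f : supported S f -> supported (S :&: nbhd v) (link v f).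
Proof.
move=> fS y; rewrite ffunE; case: ifPn => vy; first by rewrite eqxx.
rewrite mulf_eq0 negb_or => /andP[_ /fS]; rewrite clique_setU1 // subsetI.
by rewrite subUset => /andP[/andP[-> ->] /andP[_ ->]].
Qed.

Lemma supported_avoids S v g : v \notin S -> supported S g -> avoids v g.
Proof.
move=> vS gS x vx; apply/eqP; apply: contraNT vS => /gS /andP[_ /subsetP]; exact.
Qed.

Lemma notin_nbhd S v : v \notin S :&: nbhd v.
Proof. by rewrite !inE adj_irrefl andbF. Qed.

Lemma supported_cone S v g :
  v \in S -> supported (S :&: nbhd v) g -> supported S (cone v g).
Proof.
move=> vS gS x; rewrite ffunE; case: ifPn => vx; last by rewrite eqxx.
rewrite mulf_eq0 negb_or => /andP[_ /gS]; rewrite subsetI => /and3P[xC xS xv].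
by rewrite -(setD1K vx) clique_setU1 ?setD11 // xC xv /= subUset sub1set vS.
Qed.

Lemma supported_setD1 S v f : supported S f -> link v f = 0 -> supported (S :\ v) f.
Proof.
move=> fS fv x fx; have /andP[-> xS] := fS x fx; rewrite subsetD1 xS /=.
by apply: contra fx => vx; rewrite (linkE f vx) fv ffunE mulr0.
Qed.

Lemma supported_subset S S' f : S \subset S' -> supported S f -> supported S' f.
Proof. by move=> SS fS x /fS /andP[-> /subset_trans->]. Qed.

Lemma supported0 S : supported S 0.
Proof. by move=> x; rewrite ffunE eqxx. Qed.

Lemma supportedB S f g : supported S f -> supported S g -> supported S (f - g).
Proof.
move=> fS gS x; rewrite !ffunE.
have [->|/fS-> //] := eqVneq (f x) 0; rewrite sub0r oppr_eq0; exact: gS.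
Qed.

Lemma supportedN S f : supported S f -> supported S (- f).
Proof. by rewrite -sub0r; apply/supportedB/supported0. Qed.

Lemma supportedD S f g : supported S f -> supported S g -> supported S (f + g).
Proof. by move=> fS gS; rewrite -[g]opprK; apply/supportedB/supportedN. Qed.

Lemma supportedMz S f c : supported S f -> supported S (f *~ c).
Proof.
by move=> fS x; rewrite ffunMzE => fx; apply: fS; apply: contraNneq fx => ->; rewrite mul0rz.
Qed.

Lemma supported_boundary S f : supported S f -> supported S (boundary f).
Proof.
move=> fS x; rewrite ffunE => fx.
have [v] : exists v : G, f (v |: x) != 0.
  apply/existsP; apply: contraNT fx; rewrite negb_exists => /forallP f0.
  by rewrite big1 // => v _; move: (f0 v); rewrite negbK => /eqP->; rewrite mulr0.
move=> /fS/andP[vC vS].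
by rewrite (clique_subset (subsetUr _ _) vC) (subset_trans (subsetUr _ _) vS).
Qed.

Definition acyclic S := forall f, supported S f -> boundary f = 0 ->
  exists2 g, supported S g & f = boundary g.

(** The boundary at the empty simplex kills the coefficient at {v}; what remains is a multiple of
    the empty simplex, the boundary of its cone. *)
Lemma acyclic1 v : acyclic [set v].
Proof.
move=> f fS f0.
have lf : link v f = 0.
  apply/ffunP=> x; rewrite [RHS]ffunE; apply/eqP; apply/negPn/negP => lx.
  have x0 : x = set0.
    have := supported_link fS lx => /andP[_]; rewrite subsetI subset1.
    case/andP=> /orP[/eqP->|/eqP //]; by rewrite sub1set in_nbhd adj_irrefl.
  have := congr1 (fun h : chain => h x) f0; rewrite !ffunE (bigD1 v) /=; last by rewrite x0 inE.
  rewrite big1 ?addr0 => [|u /andP[_ uv]].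
    by move: lx; rewrite ffunE {1}x0 inE => /eqP.
  have [->|/fS/andP[_]] := eqVneq (f (u |: x)) 0; first by rewrite mulr0.
  by rewrite subUset sub1set inE (negbTE uv).
have fv : avoids v f by move=> x vx; rewrite (linkE f vx) lf ffunE mulr0.
exists (cone v f).
  apply: supported_cone; first by rewrite inE.
  by apply: supported_subset (supported_setD1 fS lf); rewrite setDv sub0set.
rewrite boundary_cone // f0.
suff -> : cone v 0 = 0 by rewrite subr0.
by apply/ffunP=> x; rewrite !ffunE mulr0 if_same.
Qed.

(* Cancelling the link of f at v by the boundary of a cone moves the cycle f off v. *)
Lemma supported_cancel_link S v f g : v \in S -> supported S f -> boundary f = 0 ->
  supported (S :&: nbhd v) g -> link v f = boundary g ->
  supported (S :\ v) (f + boundary (cone v g)) /\ boundary (f + boundary (cone v g)) = 0.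
Proof.
move=> vS fS f0 gS lfE.
have gv : avoids v g by apply: supported_avoids gS; apply: notin_nbhd.
rewrite raddfD /= f0 boundary_boundary addr0; split=> //.
apply: supported_setD1; last by rewrite raddfD /= link_boundary link_cone // lfE subrr.
exact/(supportedD fS)/supported_boundary/supported_cone.
Qed.

Lemma contractible_set_acyclic S : contractible_set S -> acyclic S.
Proof.
elim=> {S} [v|S v vS _ IH1 _ IH2]; first exact: acyclic1.
move=> f fS f0.
have lf0 : boundary (link v f) = 0.
  by apply/eqP; rewrite -oppr_eq0 -link_boundary f0 raddf0.
have [g gS lfE] := IH1 _ (supported_link (v := v) fS) lf0.
have [fS' f0'] := supported_cancel_link vS fS f0 gS lfE.
have [h hS hE] := IH2 _ fS' f0'.
exists (h - cone v g); last by rewrite raddfB /= -hE addrK.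
apply: supportedB; first by apply: supported_subset hS; apply: subsetDl.
exact: supported_cone.
Qed.

(** Reduced homology of S, all degrees taken together, is infinite cyclic on the class of z; the
    condition on cardinalities places z in dimension n - 1. *)
Definition fundamental_cycle n S z :=
  [/\ supported S z, forall x, z x != 0 -> #|x| = n, boundary z = 0,
      forall f, supported S f -> boundary f = 0 ->
        exists c : int, exists2 g, supported S g & f = z *~ c + boundary g
    & forall (c : int) g, supported S g -> z *~ c = boundary g -> c = 0].

(** Suspension: the cycle z' of the link bounds some e in the contractible rest, and cone v z' - e
    is closed. Its link at v is z', which transfers generation and infinite order from the link. *)
Lemma weak_sphere_fundamental_cycle n S :
  weak_sphere n S -> exists z, fundamental_cycle n S z.
Proof.
elim: n S => [|n IH] S /=.
  move=> ->; exists [ffun x : {set G} => (x == set0)%:R].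
  have sup0 f : supported set0 f -> forall x, x != set0 -> f x = 0.
    move=> fS x x0; apply/eqP; apply: contraNT x0 => /fS/andP[_].
    by rewrite subset0.
  have bd0 f : supported set0 f -> boundary f = 0.
    move=> fS; apply/ffunP=> y; rewrite !ffunE big1 // => v _.
    by rewrite sup0 ?mulr0 //; apply/set0Pn; exists v; rewrite setU11.
  have zS : supported set0 [ffun x : {set G} => (x == set0)%:R].
    by move=> x; rewrite ffunE; case: (eqVneq x set0) => [-> _|_ /eqP//]; rewrite clique0 subxx.
  split=> // [x||f fS _|c g gS].
  - by rewrite ffunE; case: (eqVneq x set0) => [-> _|_ /eqP//]; rewrite cards0.
  - exact: bd0.
  - exists (f set0); exists 0; first exact: supported0.
    rewrite raddf0 addr0; apply/ffunP=> x; rewrite ffunMzE ffunE.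
    have [->|x0] := eqVneq x set0; first by rewrite intz.
    by rewrite mul0rz; apply: sup0.
  - rewrite bd0 // => /(congr1 (fun h : chain => h set0)).
    by rewrite ffunMzE !ffunE eqxx intz.
case=> v [vS /IH[z' [zS' zn z0 zgen znz]] vC].
have z'v : avoids v z' by apply: supported_avoids zS'; apply: notin_nbhd.
have SvS : S :\ v \subset S by apply: subsetDl.
have z'S : supported (S :\ v) z'.
  apply: supported_subset zS'; apply/subsetP=> x; rewrite !inE => /andP[-> vx].
  by rewrite andbT; apply: contraTneq vx => ->; rewrite adj_irrefl.
have [e0 e0S z'E] := contractible_set_acyclic vC z'S z0.
(* Acyclicity is ungraded, so the part of [e0] on sets of n+1 vertices is cut out; its boundary is
   still z', which lives on sets of n vertices. *)
pose e := [ffun x : {set G} => if #|x| == n.+1 then e0 x else 0] : chain.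
have eS : supported (S :\ v) e.
  by move=> x; rewrite ffunE; case: ifP => _; [apply: e0S | rewrite eqxx].
have eE : boundary e = z'.
  apply/ffunP=> x; rewrite ffunE; have [xn|xn] := eqVneq #|x| n.
    rewrite z'E ffunE; apply: eq_bigr => u ux.
    by rewrite ffunE cardsU1 ux xn eqxx.
  rewrite big1 => [|u ux].
    by apply/esym/eqP; apply: contraNT xn => /zn->.
  by rewrite ffunE cardsU1 ux eqSS (negbTE xn) mulr0.
have le0 : link v e = 0.
  by apply: avoids_link0; apply: supported_avoids eS; rewrite setD11.
pose z := cone v z' - e.
have lz : link v z = z' by rewrite raddfB /= link_cone // le0 subr0.
have zS : supported S z.
  apply: supportedB; first exact: supported_cone.
  exact: supported_subset eS.
have bz : boundary z = 0.
  rewrite raddfB /= boundary_cone // z0 eE.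
  suff -> : cone v 0 = 0 by rewrite subr0 subrr.
  by apply/ffunP=> x; rewrite !ffunE mulr0 if_same.
exists z; split=> // [x|f fS f0|c g gS].
- rewrite !ffunE; case: ifP => vx.
    have [->|] := eqVneq (z' (x :\ v)) 0.
      by rewrite mulr0 sub0r oppr_eq0; case: ifP => [/eqP//|_]; rewrite eqxx.
    by move=> /zn; rewrite [in #|x| = _](cardsD1 v) vx => ->.
  by rewrite sub0r oppr_eq0; case: ifP => [/eqP//|_]; rewrite eqxx.
- have lf0 : boundary (link v f) = 0.
    by apply/eqP; rewrite -oppr_eq0 -link_boundary f0 raddf0.
  have [c [g gS lfE]] := zgen _ (supported_link (v := v) fS) lf0.
  have [|||fS' f0'] := @supported_cancel_link S v (f - z *~ c) g vS _ _ gS.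
  + by apply: supportedB => //; apply: supportedMz.
  + by rewrite raddfB raddfMz /= f0 bz mul0rz subr0.
  + by rewrite raddfB raddfMz /= lz lfE addrAC subrr add0r.
  have [h hS hE] := contractible_set_acyclic vC fS' f0'.
  exists c; exists (h - cone v g).
    apply: supportedB; first exact: supported_subset hS.
    exact: supported_cone.
  by rewrite raddfB /= -hE addrK addrC subrK.
- move/(congr1 (link v)); rewrite raddfMz /= lz link_boundary -raddfN /=.
  apply: znz; apply/supportedN; exact: supported_link.
Qed.
End Chains.

(** * Unimodularity of top cycles *)

(** The signs may be chosen separately for each r, so the condition refers to no vertex order and no
    orientation. *)
Definition signed_cycle (G : sgraph) n (S : {set G}) (c : {set G} -> int) : Prop :=
  forall r : {set G}, clique r -> r \subset S -> #|r| = n ->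
    exists e : G -> bool,
      \sum_(v in S | (v \notin r) && clique (v |: r)) (-1) ^+ e v * c (v |: r) = 0.

(* A sign-free substitute for a fundamental class: it holds for orientable
   pseudomanifolds whose n-simplices are connected through (n-1)-simplices. *)
Definition unimodular_cycles (G : sgraph) n (S : {set G}) : Prop :=
  forall c : {set G} -> int, signed_cycle n S c ->
    exists m : int, forall s : {set G},
      clique s -> s \subset S -> #|s| = n.+1 -> `|c s| = m.

Section Spheres.
Variable G : sgraph.
Implicit Types (S s t : {set G}) (v w : G).

(** Connectedness, phrased through locally constant functions. The link of v is nonempty, so v
    shares its value with a neighbour in the rest, which is connected by induction. *)
Lemma contractible_set_connected (T : Type) (f : G -> T) S : contractible_set S ->
  {in S &, forall v w, adj v w -> f v = f w} -> {in S &, forall v w, f v = f w}.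
Proof.
elim=> {S} [v _ x y /set1P-> /set1P-> //|S v vS Sv _ _ IH] fS.
have [u] := contractible_set_neq0 Sv; rewrite inE in_nbhd => /andP[uS vu].
have fvu := fS v u vS uS vu.
have uSv : u \in S :\ v by rewrite !inE uS andbT; apply: contraTneq vu => ->; rewrite adj_irrefl.
have fE x : x \in S -> f x = f u.
  move=> xS; have [->//|xv] := eqVneq x v.
  by apply: IH => //; [move=> y z /setD1P[_ yS] /setD1P[_ zS]; apply: fS | rewrite !inE xv].
by move=> x y /fE-> /fE->.
Qed.

(** The index starts at 2 because a 0-sphere, [sphere_set 1], consists of two isolated points. *)
Lemma sphere_set_connected (T : Type) n (f : G -> T) S : sphere_set n.+2 S ->
  {in S &, forall v w, adj v w -> f v = f w} -> {in S &, forall v w, f v = f w}.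
Proof.
move=> [Sv [v vS vC]] fS.
have [u] := sphere_set_neq0 (Sv v vS); rewrite inE in_nbhd => /andP[uS vu].
have fvu := fS v u vS uS vu.
have uSv : u \in S :\ v by rewrite !inE uS andbT; apply: contraTneq vu => ->; rewrite adj_irrefl.
have fE x : x \in S -> f x = f u.
  move=> xS; have [->//|xv] := eqVneq x v.
  apply: (contractible_set_connected vC) => //; last by rewrite !inE xv.
  by move=> y z /setD1P[_ yS] /setD1P[_ zS]; apply: fS.
by move=> x y /fE-> /fE->.
Qed.

Lemma sphere_set_pure n S v : sphere_set n.+1 S -> v \in S ->
  exists t, [/\ clique t, t \subset S, v \in t & #|t| = n.+1].
Proof.
elim: n S v => [|n IH] S v [Sv _] vS.
  by exists [set v]; rewrite clique1 sub1set vS inE eqxx cards1.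
have [u uS] := sphere_set_neq0 (Sv v vS).
have [t [tC tS ut tn]] := IH _ _ (Sv v vS) uS.
have vt : v \notin t by apply/negP=> /(subsetP tS); rewrite !inE adj_irrefl andbF.
move: tS; rewrite subsetI => /andP[tS tv].
exists (v |: t); rewrite clique_setU1 // tC tv subUset sub1set vS tS setU11.
by rewrite cardsU1 vt tn.
Qed.

Lemma sphere_set_dim n S t : sphere_set n S -> clique t -> t \subset S -> (#|t| <= n)%N.
Proof.
elim: n S t => [|n IH] S t /=.
  by move=> -> _; rewrite subset0 => /eqP->; rewrite cards0.
case=> Sv _ tC tS; have [->|[v vt]] := set_0Vmem t; first by rewrite cards0.
rewrite (cardsD1 v) vt ltnS; have vS := subsetP tS v vt.
move: tC; rewrite -{1}(setD1K vt) clique_setU1 ?setD11 // => /andP[tC tv].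
by apply: IH (Sv v vS) tC _; rewrite subsetI tv (subset_trans (subsetDl _ _) tS).
Qed.

Lemma signed_pair (a b : int) (e f : bool) :
  (-1) ^+ e * a + (-1) ^+ f * b = 0 -> `|a| = `|b|.
Proof. by move/eqP; rewrite addr_eq0 => /eqP/(congr1 Num.norm); rewrite normrN !normrMsign. Qed.

Lemma contractible_set_edgeless S : contractible_set S ->
  (forall v, v \in S -> S :&: nbhd v = set0) -> exists w, S = [set w].
Proof.
case=> {S} [v _|S v vS Sv _ S0]; first by exists v.
by have [u] := contractible_set_neq0 Sv; rewrite S0 // inE.
Qed.

Lemma signed_cycle_link n S v c : v \in S -> signed_cycle n.+1 S c ->
  signed_cycle n (S :&: nbhd v) (fun t => c (v |: t)).
Proof.
move=> vS cS r rC; rewrite subsetI => /andP[rS rv] rn.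
have vr : v \notin r by apply/negP=> /(subsetP rv); rewrite in_nbhd adj_irrefl.
have [||| e eE] := cS (v |: r).
- by rewrite clique_setU1 // rC.
- by rewrite subUset sub1set vS.
- by rewrite cardsU1 vr rn.
exists e; rewrite -[RHS]eE; apply: eq_big => [u|u _]; last by rewrite setUCA.
rewrite inE -andbA; case: (boolP (u \in S)) => //= uS; rewrite in_nbhd !inE negb_or.
have [->|uv] /= := eqVneq u v; first by rewrite adj_irrefl.
have [ur|ur] /= := boolP (u \in r); first by rewrite andbF.
have vur : v \notin u |: r by rewrite !inE negb_or eq_sym uv.
by rewrite setUCA (clique_setU1 vur) subUset sub1set in_nbhd rv andbT andbC.
Qed.

(** By induction on links, |c| has one value m v on all top simplices through v. Adjacent vertices
    lie in a common top simplex, so m is locally constant, and connectedness makes it constant. *)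
Lemma sphere_set_unimodular n S : sphere_set n.+1 S -> unimodular_cycles n S.
Proof.
elim: n S => [|n IH] S Ssph c cS.
  have [Sv [v vS vC]] := Ssph.
  (* In a 0-sphere all links are empty, and a contractible set without edges is one point; hence S
     has two points. *)
  have [w SwE] : exists w, S :\ v = [set w].
    apply: contractible_set_edgeless vC _ => u /setD1P[_ uS].
    by apply/eqP; rewrite -subset0 -(Sv u uS) setSI // subsetDl.
  have SE : S = [set v; w] by rewrite -(setD1K vS) SwE.
  have vw : v != w by have := set11 w; rewrite -SwE !inE eq_sym => /andP[].
  have [||e eE] := cS set0 (clique0 _); rewrite ?sub0set ?cards0 //.
  move: eE; rewrite (bigD1 v) /=; last by rewrite vS inE setU0 clique1.
  rewrite (bigD1 w) /=; last by rewrite SE !inE eqxx orbT setU0 clique1 eq_sym.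
  rewrite big1 ?addr0 => [|u /andP[/andP[/andP[uS _] uv] uw]]; last first.
    by move: uS; rewrite SE !inE (negbTE uv) (negbTE uw).
  rewrite !setU0 => /signed_pair cvw.
  exists `|c [set v]| => s _ sS /eqP/cards1P[u sE]; move: sS.
  by rewrite sE SE sub1set !inE => /orP[/eqP->|/eqP->].
have Sv := Ssph.1.
have /fin_all_exists[m mE] : forall v, exists m, v \in S ->
    forall t, clique t -> t \subset S :&: nbhd v -> #|t| = n.+1 -> `|c (v |: t)| = m.
  move=> v; have [vS|vS] := boolP (v \in S); last by exists 0.
  have [m mE] := IH _ (Sv v vS) _ (signed_cycle_link vS cS).
  by exists m.
have mS s v : clique s -> s \subset S -> #|s| = n.+2 -> v \in s -> `|c s| = m v.
  move=> sC sS sn vs; rewrite -(setD1K vs); have vS := subsetP sS v vs.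
  move: (sC); rewrite -{1}(setD1K vs) clique_setU1 ?setD11 // => /andP[svC sv].
  apply: mE => //; first by rewrite subsetI sv (subset_trans (subsetDl _ _) sS).
  by move: sn; rewrite (cardsD1 v) vs => -[].
have mC : {in S &, forall v w, m v = m w}.
  apply: (sphere_set_connected Ssph) => v w vS wS vw.
  have wSv : w \in S :&: nbhd v by rewrite inE wS in_nbhd.
  have [t [tC tS wt tn]] := sphere_set_pure (Sv v vS) wSv.
  have vt : v \notin t by apply/negP=> /(subsetP tS); rewrite !inE adj_irrefl andbF.
  move: tS; rewrite subsetI => /andP[tS tv].
  have vtC : clique (v |: t) by rewrite clique_setU1 // tC.
  have vtS : v |: t \subset S by rewrite subUset sub1set vS.
  have vtn : #|v |: t| = n.+2 by rewrite cardsU1 vt tn.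
  by rewrite -(mS _ v vtC vtS vtn) ?setU11 // (mS _ w vtC vtS vtn) // setU1r.
have [v vS] := sphere_set_neq0 Ssph; exists (m v) => s sC sS sn.
have [s0|[w ws]] := set_0Vmem s; first by move: sn; rewrite s0 cards0.
by rewrite (mS s w) //; apply: mC => //; apply: (subsetP sS).
Qed.
End Spheres.

(** * Complete flags of simplices *)

Section Flags.
Variable G : sgraph.
Implicit Types (C E H K : {set barycentric G}) (s t u : barycentric G) (r : {set G}).

Definition chain_in C r := clique C /\ forall s, s \in C -> val s \subset r.
(** A complete flag: sizes are distinct along a chain, so |r| members inside r take every size from
    1 to |r|. *)
Definition flag C r := chain_in C r /\ #|C| = #|r|.

Lemma chain_card_inj C : clique C -> {in C &, injective (fun s => #|val s|)}.
Proof.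
move=> CC s t sC tC st; apply/eqP; apply: contraT => nst.
have := cliqueP _ CC s t sC tC nst; rewrite adj_bary nst /=.
have vst : val s != val t by rewrite val_eqE.
move: st => /= st; case/orP=> sub.
  by have := eqEcard (val s) (val t); rewrite sub st leqnn (negbTE vst).
by have := eqEcard (val t) (val s); rewrite sub st leqnn eq_sym (negbTE vst).
Qed.

Lemma card_chain_between C a b : clique C ->
  (forall s, s \in C -> (a < #|val s| <= b)%N) -> (#|C| <= b - a)%N.
Proof.
move=> CC Cab; pose f s : 'I_b.+1 := inord #|val s|.
have fE s : s \in C -> f s = #|val s| :> nat.
  by move=> /Cab/andP[_ sb]; rewrite inordK.
rewrite -(card_in_imset (f := f)); last first.
  by move=> s t sC tC /(congr1 val); rewrite /= !fE //; exact: (chain_card_inj CC sC tC).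
apply: (@leq_trans #|[set i : 'I_b.+1 | (a < i)%N]|).
  apply/subset_leq_card/subsetP=> _ /imsetP[s sC ->]; rewrite inE fE //.
  by case/andP: (Cab s sC).
rewrite cardE -(size_map val) /=.
have : {subset [seq val i | i in [set i : 'I_b.+1 | (a < i)%N]] <= iota a.+1 (b - a)}.
  move=> _ /mapP[i iA ->]; move: iA; rewrite mem_enum inE mem_iota => ai.
  by have := ltn_ord i; move: ai => /=; lia.
move/uniq_leq_size; rewrite size_iota; apply.
by rewrite map_inj_uniq ?enum_uniq //; apply: val_inj.
Qed.

Lemma chain_in_card C r : chain_in C r -> (#|C| <= #|r|)%N.
Proof.
case=> CC Cr; rewrite -[leqRHS]subn0; apply: card_chain_between => // s sC.
by rewrite card_gt0 bary_neq0 subset_leq_card ?Cr.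
Qed.

Lemma chain_in0 r : chain_in set0 r.
Proof. by split; [apply: clique0 | move=> s; rewrite inE]. Qed.

Lemma clique_comparable C s t : clique C -> s \in C -> t \in C ->
  (val s \subset val t) || (val t \subset val s).
Proof.
move=> CC sC tC; have [->|st] := eqVneq s t; first by rewrite subxx.
by have := cliqueP _ CC s t sC tC st; rewrite adj_bary st.
Qed.

Lemma chain_top_exists C : clique C -> C != set0 -> exists t, chain_top C t.
Proof.
move=> CC C0; have := chain_top_unique CC C0; case: (pickP (chain_top C)) => [t|none].
  by exists t.
by rewrite big1 // => t _; rewrite none.
Qed.

(** Counting forces the sizes: the k members below the top t form a chain inside the next lower
    member r' (the empty set if there is none), and r' is properly contained in t. *)
Lemma flag_inv k C r : flag C r -> #|r| = k.+1 ->
  exists t r', [/\ val t = r, t \in C, r' \proper r, #|r'| = k & flag (C :\ t) r'].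
Proof.
case=> [[CC Cr] cC] rk; have C0 : C != set0 by rewrite -card_gt0 cC rk.
have [t tT] := chain_top_exists CC C0.
have /andP[tC /forall_inP tmax] := tT.
have Dk : #|C :\ t| = k by move: cC; rewrite rk (cardsD1 t) tC => -[].
have DC : clique (C :\ t) := clique_subset (subsetDl _ _) CC.
have [r' [r't Dr' Dr'k]] : exists r', [/\ r' \proper val t, chain_in (C :\ t) r' & (#|r'| <= k)%N].
  have tr : (#|val t| <= k.+1)%N by rewrite -rk subset_leq_card ?Cr.
  have [D0|D0] := eqVneq (C :\ t) set0.
    exists set0; rewrite D0 cards0; split=> //; last exact: chain_in0.
    by rewrite proper0 bary_neq0.
  have [u /andP[uD /forall_inP umax]] := chain_top_exists DC D0.
  have ut : val u \proper val t.
    by case/setD1P: uD => nut uC; rewrite properEneq tmax // val_eqE nut.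
  exists (val u); split=> //; rewrite -ltnS; exact: leq_trans (proper_card ut) tr.
have r'k : #|r'| = k by apply/eqP; rewrite eqn_leq Dr'k -[in leqLHS]Dk chain_in_card.
have tr : val t = r.
  apply/eqP; rewrite eqEcard Cr // rk -r'k; exact: proper_card.
exists t, r'; split=> //; first by rewrite -tr.
by split=> //; rewrite Dk r'k.
Qed.

Lemma bary_vertexP r : clique r -> r != set0 -> exists t, val t = r.
Proof.
move=> rC r0; have rP : clique r && (r != set0) by rewrite rC.
by exists (exist _ r rP).
Qed.

Lemma flag_setU1 C r' t : flag C r' -> r' \subset val t -> #|val t| = #|r'|.+1 ->
  t \notin C /\ flag (t |: C) (val t).
Proof.
move=> [[CC Cr] cC] r't tc.
have tC : t \notin C.
  by apply/negP=> /Cr/subset_leq_card; rewrite tc ltnn.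
split=> //; split; last by rewrite cardsU1 tC cC tc.
have Ct s : s \in C -> val s \subset val t by move=> /Cr /subset_trans ->.
split.
  rewrite clique_setU1 // CC; apply/subsetP=> s sC.
  rewrite inE adj_bary Ct // orbT andbT; by apply: contraNneq tC => ->.
by move=> s /setU1P[->//|/Ct].
Qed.

Lemma flag_exists r : clique r -> exists C, flag C r.
Proof.
have [n] := ubnP #|r|; elim: n r => // n IH r rn rC.
have [->|[v vr]] := set_0Vmem r.
  by exists set0; split; [apply: chain_in0 | rewrite !cards0].
have rE : #|r| = #|r :\ v|.+1 by rewrite (cardsD1 v) vr.
have [||C Cf] := IH (r :\ v); first by rewrite -ltnS -rE.
  exact: clique_subset (subsetDl _ _) rC.
have [|t tE] := bary_vertexP rC; first by apply/set0Pn; exists v.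
exists (t |: C); rewrite -tE; apply: (flag_setU1 Cf _ _).2; rewrite tE //.
exact: subsetDl.
Qed.
End Flags.

(** * Unimodularity under refinement *)

Section BarycentricUnimodular.
Variables (G : sgraph) (n : nat).
Hypothesis Gn : (clique_number G <= n.+1)%N.
Implicit Types (C E H K : {set barycentric G}) (s t u : barycentric G) (r : {set G}).

Lemma card_bary_vertex s : (#|val s| <= n.+1)%N.
Proof. exact: leq_trans (leq_clique_number (bary_clique s)) Gn. Qed.

Lemma clique_setU_bary K E : clique K -> clique E ->
  (forall s t, s \in K -> t \in E -> val s \proper val t) -> clique (K :|: E).
Proof.
move=> KC EC KE; apply/cliqueP=> s t; rewrite !inE.
case/orP=> [sK|sE] /orP[tK|tE] st.
- exact: (cliqueP _ KC).
- by rewrite adj_bary st proper_sub ?KE.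
- by rewrite adj_bary st [X in _ || X]proper_sub ?orbT ?KE.
- exact: (cliqueP _ EC).
Qed.

(** A nonempty r is itself a member of its flag, hence comparable with s; below r there is no room,
    since a chain inside r has at most |r| members. *)
Lemma flag_extend K r s : flag K r -> s \notin K -> clique (s |: K) -> r \proper val s.
Proof.
move=> Kf sK sKC; have [[KC Kr] Kc] := Kf.
case rk: #|r| => [|k].
  by rewrite (cards0_eq rk) proper0 bary_neq0.
have [u [_ [uE uK _ _ _]]] := flag_inv Kf rk.
have su : s != u by apply: contraNneq sK => ->.
have := clique_comparable sKC (setU11 s K) (setU1r s uK).
rewrite uE => /orP[sr|rs]; last by rewrite properEneq rs andbT -uE val_eqE eq_sym.
have : (#|s |: K| <= #|r|)%N.
  by apply: chain_in_card; split=> // x /setU1P[->//|/Kr].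
by rewrite cardsU1 sK Kc add1n ltnn.
Qed.

(** The diamond property of the Boolean lattice: an interval of length two has exactly two middle
    elements. *)
Lemma between_two (T : finType) (r s t t1 t2 : {set T}) :
  r \subset s -> r \subset t1 -> r \subset t2 ->
  s \subset t -> t1 \subset t -> t2 \subset t ->
  #|s| = #|r|.+1 -> #|t1| = #|r|.+1 -> #|t2| = #|r|.+1 -> #|t| = #|r|.+2 ->
  t1 != t2 -> s = t1 \/ s = t2.
Proof.
move=> rs rt1 rt2 st t1t t2t sc t1c t2c tc t12.
have one (a : {set T}) : r \subset a -> #|a| = #|r|.+1 -> exists2 v, a = v |: r & v \notin r.
  move=> ra ac; have /eqP/cards1P[v vE] : #|a :\: r| = 1%N.
    by rewrite cardsD (setIidPr ra) ac subSnn.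
  exists v; last by have := set11 v; rewrite -vE inE => /andP[].
  by rewrite -[LHS](setID a r) (setIidPr ra) setUC vE.
have [v vE vr] := one s rs sc.
have [v1 v1E v1r] := one t1 rt1 t1c.
have [v2 v2E v2r] := one t2 rt2 t2c.
have v12 : v1 != v2 by apply: contraNneq t12 => vv; rewrite v1E v2E vv.
have tE : t :\: r = [set v1; v2].
  apply/esym/eqP; rewrite eqEcard; apply/andP; split.
    apply/subsetP=> x; rewrite !inE => /orP[]/eqP->.
      by rewrite v1r (subsetP t1t) // v1E setU11.
    by rewrite v2r (subsetP t2t) // v2E setU11.
  rewrite cards2 v12 cardsD tc (setIidPr (subset_trans rs st)).
  by rewrite -addn2 addnC addnK.
have : v \in t :\: r by rewrite inE vr (subsetP st) // vE setU11.
by rewrite tE !inE vE v1E v2E => /orP[]/eqP->; [left | right].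
Qed.

Variable c : {set barycentric G} -> int.
Hypothesis cC : signed_cycle n [set: barycentric G] c.

Lemma signed_cycle_at C : clique C -> #|C| = n -> exists e : barycentric G -> bool,
  \sum_(s | (s \notin C) && clique (s |: C)) (-1) ^+ e s * c (s |: C) = 0.
Proof.
move=> CC Cn; have [|e eE] := cC CC _ Cn; first exact: subsetT.
by exists e; rewrite -[RHS]eE; apply: eq_bigl => s; rewrite inE.
Qed.

(* Two flags of r below a fixed upper chain E: descend to the facets r1, r2 of r
   in the flags; if these differ, pass through flags containing r1 :&: r2, where
   the chain missing the level of r1 and r2 has exactly two completions. *)
Lemma norm_flag k r E H1 H2 : #|r| = k -> clique r -> clique E ->
  (forall s, s \in E -> r \proper val s) -> (#|E| + k = n.+1)%N ->
  flag H1 r -> flag H2 r -> `|c (H1 :|: E)| = `|c (H2 :|: E)|.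
Proof.
elim: k r E H1 H2 => [|k IH] r E H1 H2 rk rC EC Er En H1f H2f.
  have H0 H : flag H r -> H = set0.
    by case=> _; rewrite rk; apply: cards0_eq.
  by rewrite (H0 _ H1f) (H0 _ H2f).
have [t [r1 [tE tH1 r1r r1k H1f']]] := flag_inv H1f rk.
have [t' [r2 [tE' tH2 r2r r2k H2f']]] := flag_inv H2f rk.
have tt : t' = t by apply: val_inj; rewrite tE tE'.
rewrite {}tt in tH2 H2f' tE' *.
pose E' := t |: E.
have tE0 : t \notin E by apply/negP=> /Er; rewrite tE properxx.
have HE H : t \in H -> H :|: E = (H :\ t) :|: E'.
  by move=> tH; rewrite /E' setUCA setUA setD1K.
have E'C : clique E'.
  rewrite /E' clique_setU1 // EC; apply/subsetP=> s sE.
  rewrite inE adj_bary tE proper_sub ?Er // andbT.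
  by apply: contraNneq tE0 => ->.
have E'r r' : r' \proper r -> forall s, s \in E' -> r' \proper val s.
  move=> r'r s /setU1P[->|/Er rs]; first by rewrite tE.
  exact: proper_trans r'r rs.
have E'n : (#|E'| + k = n.+1)%N by rewrite cardsU1 tE0 -En add1n addSnnS.
have IHr r' H H' : r' \proper r -> #|r'| = k -> flag H r' -> flag H' r' ->
    `|c (H :|: E')| = `|c (H' :|: E')|.
  move=> r'r r'k; apply: IH => //; first exact: clique_subset (proper_sub r'r) rC.
  exact: E'r.
rewrite (HE H1) // (HE H2) //.
have [r12|r12] := eqVneq r1 r2; first by apply: (IHr r1) => //; rewrite r12.
have r1C := clique_subset (proper_sub r1r) rC.
have r2C := clique_subset (proper_sub r2r) rC.
pose q := r1 :&: r2.
have qk : k = #|q|.+1.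
  have U1 : (k < #|r1 :|: r2|)%N.
    rewrite -r1k; apply: proper_card; rewrite properEneq subsetUl andbT.
    apply: contra_neq r12 => r1E; apply/esym/eqP.
    by rewrite eqEcard r1k r2k leqnn andbT r1E subsetUr.
  have U2 : (#|r1 :|: r2| <= k.+1)%N.
    by rewrite -rk subset_leq_card // subUset !proper_sub.
  have UE : #|r1 :|: r2| = k.+1 by apply/eqP; rewrite eqn_leq U1 U2.
  by have := cardsUI r1 r2; rewrite -/q r1k r2k UE addSnnS => /addnI.
have [K Kf] := flag_exists (clique_subset (subsetIl r1 r2) r1C).
have nz r' : #|r'| = k -> r' != set0 by rewrite -card_gt0 qk => ->.
have [t1 t1E] := bary_vertexP r1C (nz _ r1k).
have [t2 t2E] := bary_vertexP r2C (nz _ r2k).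
have [|| t1K t1f] := flag_setU1 (t := t1) Kf; rewrite ?t1E ?subsetIl -/q -?qk //.
have [|| t2K t2f] := flag_setU1 (t := t2) Kf; rewrite ?t2E ?subsetIr -/q -?qk //.
rewrite t1E in t1f; rewrite t2E in t2f.
rewrite (IHr _ _ _ r1r r1k H1f' t1f) (IHr _ _ _ r2r r2k H2f' t2f) -!setUA.
have [[KC Kq] Kc] := Kf.
have qr : q \proper r by apply: sub_proper_trans r1r; apply: subsetIl.
pose C := K :|: E'; rewrite -/C.
have CC : clique C.
  by apply: clique_setU_bary => // s u /Kq sq uE; apply: sub_proper_trans sq (E'r _ qr u uE).
have KE' : [disjoint K & E'].
  rewrite -setI_eq0 -subset0; apply/subsetP=> s /setIP[/Kq sq /(E'r _ qr)].
  by rewrite properE sq andbF.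
have Cn : #|C| = n.
  rewrite /C cardsU (disjoint_setI0 KE') cards0 subn0 Kc.
  by move: E'n; rewrite qk addnS => -[<-]; rewrite addnC.
have tiC (ti : barycentric G) (ri : {set G}) : val ti = ri -> ri \proper r -> flag (ti |: K) ri -> clique (ti |: C).
  move=> tiE rir [[tiKC tir] _]; rewrite /C setUA; apply: clique_setU_bary => //.
  by move=> s u /tir sri uE; apply: sub_proper_trans sri (E'r _ rir u uE).
have tiN (ti : barycentric G) (ri : {set G}) : val ti = ri -> ri \proper r -> ti \notin K -> ti \notin C.
  move=> tiE rir tiK; rewrite inE (negbTE tiK) /=; apply/negP=> /(E'r _ rir).
  by rewrite tiE properxx.
have [e] := signed_cycle_at CC Cn.
rewrite (bigD1 t1) /=; last by rewrite (tiN _ r1) // (tiC _ r1).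
rewrite (bigD1 t2) /=; last first.
  by rewrite (tiN _ r2) // (tiC _ r2) // -val_eqE t1E t2E eq_sym.
rewrite big1 ?addr0; first exact: signed_pair.
(* A third completion s is excluded: comparability with t puts it below r, the flag K puts it above
   q, and only r1 and r2 lie in between. *)
move=> s /andP[/andP[/andP[sC sCC] st1] st2]; exfalso.
have tC : t \in C by rewrite !inE eqxx orbT.
have st : s != t by apply: contraNneq sC => ->.
have sK : s \notin K by apply: contra sC; rewrite inE => ->.
have sE : s \notin E by apply: contra sC; rewrite !inE => ->; rewrite !orbT.
(* Above r, the simplex s together with E would form a chain with more members than there are sizes
   from k.+2 to n.+1. *)
have sr : val s \subset r.
  have := clique_comparable sCC (setU11 s C) (setU1r s tC); rewrite tE => /orP[//|rs].
  have rs' : r \proper val s by rewrite properEneq rs andbT -tE val_eqE eq_sym.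
  have sEC : @clique (barycentric G) (s |: E).
    apply: clique_subset sCC; apply/setUS/subsetP=> x xE.
    by rewrite !inE xE !orbT.
  have /(card_chain_between sEC) : forall x, x \in s |: E -> (k.+1 < #|val x| <= n.+1)%N.
    move=> x xE; rewrite card_bary_vertex andbT -rk; apply: proper_card.
    by case/setU1P: xE => [->//|/Er].
  by rewrite cardsU1 sE -En addnK add1n ltnn.
have qs : q \proper val s.
  apply: flag_extend Kf sK _; apply: clique_subset sCC; apply/setUS/subsetUl.
have sk : #|val s| = #|q|.+1.
  apply/eqP; rewrite eqn_leq (proper_card qs) andbT -qk -ltnS -rk; apply: proper_card.
  by rewrite properEneq sr -tE val_eqE st.
have := between_two (proper_sub qs) (subsetIl r1 r2) (subsetIr r1 r2) sr
  (proper_sub r1r) (proper_sub r2r) sk (etrans r1k qk) (etrans r2k qk)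
  (etrans rk (congr1 succn qk)) r12.
case=> sri; first by rewrite -val_eqE t1E sri eqxx in st1.
by rewrite -val_eqE t2E sri eqxx in st2.
Qed.
End BarycentricUnimodular.

(** By [norm_flag] with empty E, |c| at a flag depends only on its top simplex, which defines c' on
    G. A flag E of a simplex r with n vertices is completed exactly by the simplices v |: r, so the
    cycle condition of c at E becomes that of c' at r. *)
Lemma unimodular_cycles_barycentric (G : sgraph) n : (clique_number G <= n.+1)%N ->
  unimodular_cycles n [set: G] -> unimodular_cycles n [set: barycentric G].
Proof.
move=> Gn Gu c cC.
have /fin_all_exists[c' c'E] : forall r : {set G}, exists m : int,
    clique r -> #|r| = n.+1 -> forall C, flag C r -> `|c C| = m.
  move=> r; have [/andP[rC /eqP rn]|rn] := boolP (clique r && (#|r| == n.+1)).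
    have [C0 C0f] := flag_exists rC; exists `|c C0| => _ _ C Cf.
    have := @norm_flag _ _ Gn c cC n.+1 r set0 C C0; rewrite !setU0; apply=> //.
    - exact: clique0.
    - by move=> s; rewrite inE.
    - by rewrite cards0.
  by exists 0 => rC rn'; rewrite rC rn' eqxx in rn.
have c'C : signed_cycle n [set: G] c'.
  move=> r rC _ rn; have [E Ef] := flag_exists rC; have [[EC Er] Ec] := Ef.
  have [e eE] := signed_cycle_at cC EC (etrans Ec rn).
  (* [h] and [h'] are inverse to each other between the vertices v extending r to a simplex and the
     members s completing E. *)
  pose h (v : G) : barycentric G := insubd (bary_vertex1 v) (v |: r).
  pose h' (s : barycentric G) := [pick v in val s :\: r].
  have hE v : clique (v |: r) -> val (h v) = v |: r.
    move=> vC; rewrite val_insubd vC /= ifT //; by apply/set0Pn; exists v; rewrite setU11.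
  have sE s : s \notin E -> clique (s |: E) -> exists2 v, v \notin r & val s = v |: r.
    move=> sE sEC; have rs := flag_extend Ef sE sEC.
    have sn : #|val s| = n.+1.
      by apply/eqP; rewrite eqn_leq (card_bary_vertex Gn) -rn proper_card.
    have /eqP/cards1P[v vE] : #|val s :\: r| = 1%N.
      by rewrite cardsD (setIidPr (proper_sub rs)) sn rn subSnn.
    exists v; first by have := set11 v; rewrite -vE inE => /andP[].
    by rewrite -[LHS](setID (val s) r) (setIidPr (proper_sub rs)) setUC vE.
  have hf v : v \notin r -> clique (v |: r) -> h v \notin E /\ flag (h v |: E) (v |: r).
    move=> vr vC; rewrite -[X in flag _ X](hE v vC).
    by apply: flag_setU1 Ef _ _; rewrite hE ?subsetUr // cardsU1 vr.
  (* The sign of c is absorbed into the free sign, since c' records only absolute values. *)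
  exists (fun v => e (h v) (+) (c (h v |: E) < 0)).
  rewrite -[RHS]eE (reindex_omap h h') => [|s /andP[sE1 sE2]]; last first.
    have [v vr sv] := sE s sE1 sE2.
    have svC : clique (v |: r) by rewrite -sv bary_clique.
    rewrite /h' sv; case: pickP => [u|/(_ v)]; last by rewrite !inE vr eqxx.
    rewrite !inE => /andP[ur] /orP[/eqP uv|]; last by rewrite (negbTE ur).
    by rewrite /= uv; congr Some; apply: val_inj; rewrite hE.
  apply: eq_big => [v|v].
    rewrite inE /=; apply/andP/andP => [[vr vC]|[/andP[hvE hvC] /eqP]].
      have [hvE [[hvC _] _]] := hf v vr vC; rewrite hvE hvC; split=> //.
      rewrite /h' hE //; case: pickP => [u|/(_ v)]; last by rewrite !inE vr eqxx.
      by rewrite !inE => /andP[ur] /orP[/eqP->//|]; rewrite (negbTE ur).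
    rewrite /h'; case: pickP => // u; rewrite inE => /andP[ur us] [uv].
    rewrite uv in ur us; split=> //; have [w wr sw] := sE _ hvE hvC.
    move: us; rewrite sw !inE (negbTE ur) orbF => /eqP->.
    by rewrite -sw bary_clique.
  rewrite inE /= => /andP[vr vC]; have [_ hvf] := hf v vr vC.
  have vn : #|v |: r| = n.+1 by rewrite cardsU1 vr rn.
  rewrite -(c'E _ vC vn _ hvf) signr_addb -mulrA; congr (_ * _).
  by rewrite -numEsign.
have [m mE] := Gu c' c'C; exists m => F FC _ Fn.
have [t tF] : exists t, chain_top F t by apply: chain_top_exists; rewrite // -card_gt0 Fn.
have Ft : chain_in F (val t).
  by split=> // s; case/andP: tF => _ /forall_inP; apply.
have tn : #|val t| = n.+1.
  by apply/eqP; rewrite eqn_leq (card_bary_vertex Gn) -Fn chain_in_card.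
have Ff : flag F (val t) by split=> //; rewrite Fn.
rewrite (c'E _ (bary_clique t) tn _ Ff) -(mE _ (bary_clique t) _ tn) ?subsetT //.
by rewrite -(c'E _ (bary_clique t) tn _ Ff) normr_id.
Qed.

(** * Covolumes of integral lattices *)

Section IntegralSplitting.

(** Regularity forces the elementary divisors to be 0 or units, so the columns of U and the rows of
    V are bases of saturated lattices; P and Q certify the saturation. *)
Lemma regular_mx_splitting m n (M : 'M[int]_(m, n)) (H : 'M[int]_(n, m)) :
  M *m H *m M = M ->
  exists r (U : 'M[int]_(m, r)) (V : 'M[int]_(r, n))
           (P : 'M[int]_(r, m)) (Q : 'M[int]_(n, r)),
    [/\ M = U *m V, P *m U = 1%:M & V *m Q = 1%:M].
Proof.
move=> MHM; have [L uL [R uR [d _ ME]]] := int_Smith_normal_form M.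
pose D : 'M[int]_(m, n) := \matrix_(i, j) (d`_i *+ (i == j :> nat)).
rewrite -/D in ME.
(* In Smith form, with K = R H L, regularity reads d_i K_ii d_i = d_i on the diagonal, so every
   nonzero d_i is a unit. *)
have DKD : D *m (R *m H *m L) *m D = D.
  apply: (can_inj (mulKmx uL)); apply: (can_inj (mulmxK uR)).
  by rewrite -ME -[RHS]MHM ME !mulmxA.
pose I := [set i : 'I_m | (i < n)%N && (d`_i != 0)].
pose e (k : 'I_#|I|) : 'I_m := enum_val k.
have eI k : (e k < n)%N && (d`_(e k) != 0).
  by have := enum_valP k; rewrite inE.
have d1 i : i \in I -> d`_i * d`_i = 1.
  rewrite inE => /andP[ltin di].
  have := congr1 (fun A : 'M_(m, n) => A i (Ordinal ltin)) DKD; rewrite !mxE.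
  rewrite (bigD1 i) //= big1 ?addr0 => [|j ji]; last first.
    by rewrite [D j _]mxE (negbTE (ji : j != i :> nat)) mulr0.
  rewrite !mxE (bigD1 (Ordinal ltin)) //= big1 ?addr0 => [|j ji]; last first.
    rewrite [D i j]mxE; case: eqP => [ij|_]; last by rewrite mul0r.
    by case/eqP: ji; apply: val_inj.
  rewrite !mxE eqxx !mulr1n -mulrA -[RHS]mulr1 => /(mulfI di) kd.
  by have /orP[] := intUnitRing.unitzPl kd => /eqP->.
pose E : 'M[int]_(m, #|I|) := \matrix_(i, k) (i == e k)%:R.
pose F : 'M[int]_(#|I|, n) := \matrix_(k, j) (d`_(e k) *+ (e k == j :> nat)).
have DE : D = E *m F.
  apply/matrixP=> i j; rewrite !mxE; have [iI|iI] := boolP (i \in I).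
    rewrite (bigD1 (enum_rank_in iI i)) //= big1 ?addr0 => [|k ki].
      by rewrite !mxE /e enum_rankK_in // eqxx mul1r.
    rewrite !mxE; case: eqP => [ik|_]; last by rewrite mul0r.
    by case/eqP: ki; apply: enum_val_inj; rewrite enum_rankK_in.
  rewrite big1 => [|k _]; last first.
    rewrite !mxE; case: eqP => [ik|_]; last by rewrite mul0r.
    by rewrite ik enum_valP in iI.
  case: eqP => // ij; move: iI; rewrite inE ij ltn_ord /= negbK => /eqP.
  by rewrite -ij => ->.
exists #|I|, (L *m E), (F *m R), (E^T *m invmx L), (invmx R *m F^T); split.
- by rewrite ME DE !mulmxA.
- rewrite mulmxA mulmxKV //; apply/matrixP=> k l; rewrite !mxE.
  rewrite (bigD1 (e k)) //= big1 ?addr0 => [|i ik]; last first.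
    by rewrite !mxE (negbTE ik) mul0r.
  by rewrite !mxE eqxx mul1r (inj_eq enum_val_inj).
- rewrite mulmxA mulmxK //; apply/matrixP=> k l; rewrite !mxE.
  have /andP[ltk _] := eI k.
  rewrite (bigD1 (Ordinal ltk)) //= big1 ?addr0 => [|j jk]; last first.
    rewrite [F k j]mxE; case: eqP => [kj|_]; last by rewrite mul0r.
    by case/eqP: jk; apply: val_inj.
  rewrite !mxE /= eqxx mulr1n; have [<-|kl] := eqVneq k l.
    by rewrite eqxx mulr1n d1 // enum_valP.
  case: eqP => [/val_inj/enum_val_inj/eqP|_]; last by rewrite mulr0.
  by rewrite eq_sym (negbTE kl).
Qed.

Lemma mulmx_tr_eq0 n (u : 'rV[int]_n) : u *m u^T = 0 -> u = 0.
Proof.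
move=> /(congr1 (fun A : 'M_1 => A 0 0)); rewrite !mxE => u0.
have /psumr_eq0P u00 : forall i, true -> 0 <= u 0 i * u^T i 0.
  by move=> i _; rewrite mxE -expr2 sqr_ge0.
apply/rowP=> i; have /eqP := u00 u0 i isT.
by rewrite !mxE mulf_eq0 orbb => /eqP.
Qed.

Lemma det_gram_neq0 s n (V : 'M[int]_(s, n)) (Q : 'M[int]_(n, s)) :
  V *m Q = 1%:M -> \det (V *m V^T) != 0.
Proof.
move=> VQ; apply/negP=> /det0P[u u0 uVV].
have uV : u *m V = 0.
  by apply: mulmx_tr_eq0; rewrite trmx_mul !mulmxA -(mulmxA u) uVV mul0mx.
by move: u0; rewrite -[u]mulmx1 -VQ mulmxA uV mul0mx eqxx.
Qed.

(* A saturated lattice and its orthogonal complement have the same covolume. *)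
Lemma det_gram_dual n r s (U : 'M[int]_(n, r)) (P : 'M[int]_(r, n))
    (V : 'M[int]_(s, n)) (Q : 'M[int]_(n, s)) (X : 'M[int]_(n, s)) :
  P *m U = 1%:M -> V *m Q = 1%:M -> V *m U = 0 -> 1%:M - U *m P = X *m V ->
  \det (U^T *m U) = \det (V *m V^T).
Proof.
move=> PU VQ VU XV.
have XE : V *m X = 1%:M.
  have : V *m X *m V = V by rewrite -mulmxA -XV mulmxBr mulmx1 mulmxA VU mul0mx subr0.
  by move=> /(congr1 (mulmx^~ Q)); rewrite -mulmxA VQ mulmx1.
have PX : P *m X = 0.
  have : P *m X *m V = 0 by rewrite -mulmxA -XV mulmxBr mulmx1 mulmxA PU mul1mx subrr.
  by move=> /(congr1 (mulmx^~ Q)); rewrite -mulmxA VQ mulmx1 mul0mx.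
have NN : col_mx P V *m row_mx U X = 1%:M.
  by rewrite mul_col_row PU PX VU XE -scalar_mx_block.
have NN' : row_mx U X *m col_mx P V = 1%:M.
  by rewrite mul_row_col -XV addrC subrK.
have rsn : (r + s)%N = n.
  by apply/eqP; rewrite eqn_leq (mulmx1_min NN) (mulmx1_min NN').
case: n / rsn U P V Q X PU VQ VU XV XE PX NN NN' => U P V Q X PU VQ VU XV XE PX NN NN'.
(* N is unimodular. N M is block triangular with diagonal blocks 1 and V V^T, while M^T M has the
   diagonal blocks U^T U and V V^T; comparing determinants gives the claim. *)
set N := col_mx P V in NN NN'; pose M := row_mx U V^T.
have dN : \det N ^+ 2 = 1.
  have : \det N * \det (row_mx U X) = 1 by rewrite -det_mulmx NN det1.
  by rewrite mulrC => /intUnitRing.unitzPl/orP[] /eqP->.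
have dNM : \det N * \det M = \det (V *m V^T).
  by rewrite -det_mulmx mul_col_row PU VU det_ublock det1 mul1r.
have dM : \det M ^+ 2 = \det (U^T *m U) * \det (V *m V^T).
  rewrite expr2 -{1}det_tr -det_mulmx tr_row_mx mul_col_row trmxK VU.
  by rewrite det_ublock.
have := det_gram_neq0 VQ => dV.
apply: (mulIf dV); rewrite -dM -dNM -expr2 exprMn dN mul1r //.
Qed.

End IntegralSplitting.

(** * Gram determinants along an exact integral complex *)

Section ExactComplex.
Variables (n : nat -> nat) (M : forall j, 'M[int]_(n j.+1, n j)) (N : nat).
Hypothesis MM : forall j, M j.+1 *m M j = 0.
Hypothesis exact0 : forall f : 'rV_(n 0), exists g, f = g *m M 0.
Hypothesis exactS : forall j, (j < N)%N ->
  forall f : 'rV_(n j.+1), f *m M j = 0 -> exists g, f = g *m M j.+1.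

Lemma lift_rows (p q k : nat) (K : 'M[int]_(p, q)) (A : 'M[int]_(k, q)) :
  (forall i, exists g, row i A = g *m K) -> exists Y, A = Y *m K.
Proof.
move=> /fin_all_exists[g gE]; exists (\matrix_(i < k) g i).
by apply/row_matrixP=> i; rewrite gE row_mul rowK.
Qed.

Lemma exactS_lift j k (A : 'M[int]_(k, n j.+1)) :
  (j < N)%N -> A *m M j = 0 -> exists Y, A = Y *m M j.+1.
Proof.
move=> jN AM; apply: lift_rows => i; apply: exactS => //.
by rewrite -row_mul AM row0.
Qed.

(** A contracting homotopy, built degree by degree: if H splits [M j], the rows of 1 - M j H are
    cycles, and lifting them through [M j.+1] yields a splitting of [M j.+1]. *)
Lemma exact_regular j : (j <= N)%N -> exists H, M j *m H *m M j = M j.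
Proof.
elim: j => [_|j IH jN].
  have [|H HE] := @lift_rows _ _ _ (M 0) 1%:M; first by move=> i; apply: exact0.
  by exists H; rewrite -mulmxA -HE mulmx1.
have [H HE] := IH (ltnW jN).
have [|K KE] := @exactS_lift j _ (1%:M - M j *m H) jN.
  by rewrite mulmxBl mul1mx HE subrr.
by exists K; rewrite -mulmxA -KE mulmxBr mulmx1 mulmxA MM mul0mx subr0.
Qed.

(** By exactness the row lattice of [M j.+1] is the orthogonal complement of the column lattice of
    [M j], so [t j.+1] is the squared covolume of both; [t 0] is 1 as [M 0] is onto. The last clause
    admits any basis of the last kernel: the next matrix supplies one in the induction, the
    fundamental cycle at the end. *)
Lemma exact_gram_factors m : (m <= N)%N ->
  exists t : nat -> int, t 0%N = 1 /\
    (forall j, (j <= m)%N ->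
      exists r (U : 'M[int]_(_, r)) (V : 'M[int]_(r, _)),
        [/\ M j = U *m V, \det (U^T *m U) = t j.+1, \det (V *m V^T) = t j,
            t j != 0 & t j.+1 != 0]) /\
    (forall s (V : 'M[int]_(s, n m.+1)) (Q : 'M[int]_(n m.+1, s)),
      V *m Q = 1%:M -> V *m M m = 0 ->
      (forall k (A : 'M[int]_(k, n m.+1)), A *m M m = 0 -> exists Y, A = Y *m V) ->
      \det (V *m V^T) = t m.+1).
Proof.
have dual j r (U : 'M[int]_(n j.+1, r)) (V : 'M[int]_(r, n j)) P Q :
    M j = U *m V -> P *m U = 1%:M -> V *m Q = 1%:M ->
    forall s (W : 'M[int]_(s, n j.+1)) (W' : 'M[int]_(n j.+1, s)),
      W *m W' = 1%:M -> W *m M j = 0 ->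
      (forall k (A : 'M[int]_(k, n j.+1)), A *m M j = 0 -> exists Y, A = Y *m W) ->
      \det (W *m W^T) = \det (U^T *m U).
  move=> ME PU VQ s W W' WW WM Wex.
  have [|Y YE] := Wex _ (1%:M - U *m P).
    by rewrite ME mulmxA mulmxBl mul1mx -mulmxA PU mulmx1 subrr mul0mx.
  apply/esym/(det_gram_dual PU WW _ YE).
  by rewrite -[U]mulmx1 -VQ !mulmxA -(mulmxA W) -ME WM mul0mx.
have gramU p r (U : 'M[int]_(p, r)) P : P *m U = 1%:M -> \det (U^T *m U) != 0.
  move=> PU; rewrite -{2}[U]trmxK; apply: (@det_gram_neq0 _ _ _ P^T).
  by rewrite -trmx_mul PU trmx1.
elim: m => [_|m IH mN].
  have [H HE] := exact_regular (leq0n N).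
  have [r [U [V [P [Q [ME PU VQ]]]]]] := regular_mx_splitting HE.
  exists (fun j => if j is 0%N then 1 else \det (U^T *m U)); split=> //.
  have VV : \det (V *m V^T) = 1.
    have [|K KE] := @lift_rows _ _ _ (M 0) 1%:M; first by move=> i; apply: exact0.
    rewrite -(@det_gram_dual _ 0 _ 0 0 V Q (K *m U)) ?det_mx00 //.
    - by rewrite [_ *m _]flatmx0 [RHS]flatmx0.
    - by rewrite mulmx0.
    - by rewrite mul0mx subr0 KE ME !mulmxA.
  split; last exact: dual ME PU VQ.
  move=> [] // _; exists r, U, V; split=> //; exact: gramU PU.
have [t [t0 [tE tlast]]] := IH (ltnW mN).
have [H HE] := exact_regular mN.
have [r [U [V [P [Q [ME PU VQ]]]]]] := regular_mx_splitting HE.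
exists (fun j => if j == m.+2 then \det (U^T *m U) else t j); rewrite eqxx.
split=> //; split; last exact: dual ME PU VQ.
have VV : \det (V *m V^T) = t m.+1.
  apply: tlast VQ _ _.
    have := MM m; rewrite ME => /(congr1 (mulmx P)).
    by rewrite !mulmxA PU mul1mx mulmx0.
  move=> k A /(exactS_lift mN)[Y ->]; exists (Y *m U).
  by rewrite ME !mulmxA.
move=> j; rewrite leq_eqVlt => /predU1P[->|jm].
  rewrite !eqxx eqn_leq ltnn andbF; exists r, U, V; rewrite -VV.
  by split=> //; [apply: det_gram_neq0 VQ | apply: gramU PU].
by rewrite !ltn_eqF //; [apply: tE | rewrite ltnS ltnW].
Qed.

End ExactComplex.

(** * Boundary matrices and the fundamental cycle *)

Section BoundaryMatrices.
Variables (G : sgraph) (le : rel G).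
Hypothesis leL : linear_order le.

Local Notation chain := {ffun {set G} -> int}.
Local Notation sgn := (sgn le).
Local Notation boundary := (boundary le).

(** Indexed by the number of vertices, so that [cliques 0] holds the empty simplex and
    [cliques j.+1] is convertible with [simplices G j]. *)
Definition cliques (j : nat) : {set {set G}} := [set s | clique s & #|s| == j].

Definition incidence_int (y x : {set G}) : int :=
  \sum_(v in x | y == x :\ v) sgn v x.

Definition boundary_mx (j : nat) : 'M[int]_(#|cliques j.+1|, #|cliques j|) :=
  \matrix_(i, k) incidence_int (enum_val k) (enum_val i).

Definition chain_row j (f : chain) : 'rV[int]_#|cliques j| :=
  \row_i f (enum_val i).

Definition row_chain j (u : 'rV[int]_#|cliques j|) : chain :=
  [ffun x : {set G} => \sum_i u 0 i *+ (enum_val i == x)].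

Lemma enum_cliqueP j (i : 'I_#|cliques j|) :
  clique (enum_val i) /\ #|enum_val i| = j.
Proof. by have := enum_valP i; rewrite inE => /andP[-> /eqP]. Qed.

Lemma row_chainK j (u : 'rV[int]_#|cliques j|) : chain_row j (row_chain u) = u.
Proof.
apply/rowP=> i; rewrite !mxE ffunE (bigD1 i) //= eqxx mulr1n big1 ?addr0 // => k ki.
by rewrite (inj_eq enum_val_inj) (negbTE ki).
Qed.

Lemma row_chain_neq0 j (u : 'rV[int]_#|cliques j|) x :
  row_chain u x != 0 -> clique x /\ #|x| = j.
Proof.
rewrite ffunE => ux; have [i] : exists i : 'I_#|cliques j|, enum_val i == x.
  apply/existsP; apply: contraNT ux; rewrite negb_exists => /forallP ix.
  by rewrite big1 // => i _; rewrite (negbTE (ix i)).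
by move/eqP <-; apply: enum_cliqueP.
Qed.

Lemma supported_row_chain j (u : 'rV[int]_#|cliques j|) :
  supported [set: G] (row_chain u).
Proof. by move=> x /row_chain_neq0[-> _]; rewrite subsetT. Qed.

Lemma chain_row_boundary j (f : chain) : supported [set: G] f ->
  chain_row j (boundary f) = chain_row j.+1 f *m boundary_mx j.
Proof.
move=> fS; apply/rowP=> k; rewrite !mxE.
have [yC yj] := enum_cliqueP k; set y := enum_val k in yC yj *.
transitivity (\sum_(x in cliques j.+1) f x * incidence_int y x); last first.
  rewrite big_enum_val /=; apply: eq_bigr => i _.
  by rewrite !mxE.
rewrite ffunE /incidence_int.
transitivity (\sum_(x in cliques j.+1) \sum_(v | (v \in x) && (y == x :\ v)) f x * sgn v x); last first.
  by apply: eq_bigr => x _; rewrite mulr_sumr.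
rewrite (exchange_big_dep (fun v => v \notin y)) /=; last first.
  by move=> x v _ /andP[_ /eqP->]; rewrite setD11.
apply: eq_bigr => v vy.
have [vyC|vyC] := boolP (clique (v |: y)).
  rewrite (bigD1 (v |: y)) /=; last by rewrite inE vyC cardsU1 vy yj setU11 setU1K ?eqxx.
  rewrite big1 ?addr0 ?sgn_setU1 1?mulrC // => x /andP[/and3P[_ vx /eqP yE] /eqP[]].
  by rewrite yE setD1K.
have -> : f (v |: y) = 0.
  by apply/eqP; apply: contraNT vyC => /fS/andP[].
rewrite mulr0 big1 // => x /and3P[]; rewrite inE => /andP[xC _] vx /eqP yE.
by rewrite yE setD1K // xC in vyC.
Qed.

Lemma boundary_mx_comp j : boundary_mx j.+1 *m boundary_mx j = 0.
Proof.
apply/row_matrixP=> i; rewrite row0 rowE mulmxA.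
rewrite -[delta_mx 0 i]row_chainK -!chain_row_boundary ?boundary_boundary //.
- by apply/rowP=> k; rewrite !mxE ffunE.
- exact/supported_boundary/supported_row_chain.
- exact: supported_row_chain.
Qed.

Lemma row_chain_cycle j (u : 'rV[int]_#|cliques j.+1|) :
  u *m boundary_mx j = 0 -> boundary (row_chain u) = 0.
Proof.
move=> u0; apply/ffunP=> y; rewrite [RHS]ffunE.
have [//|by0] := eqVneq (boundary (row_chain u) y) 0.
have /andP[yC _] := supported_boundary (supported_row_chain (u := u)) by0.
have yj : #|y| = j.
  move: by0; rewrite ffunE => by0.
  have [v] : exists v : G, (v \notin y) && (row_chain u (v |: y) != 0).
    apply/existsP; apply: contraNT by0; rewrite negb_exists => /forallP f0.
    rewrite big1 // => v vy; move: (f0 v).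
    by rewrite vy negbK => /eqP->; rewrite mulr0.
  by case/andP=> vy /row_chain_neq0[_]; rewrite cardsU1 vy => -[].
have ycl : y \in cliques j by rewrite inE yC yj eqxx.
have := chain_row_boundary j (supported_row_chain (u := u)); rewrite row_chainK u0.
move/rowP/(_ (enum_rank_in ycl y)); rewrite !mxE enum_rankK_in //.
Qed.

Lemma row_chain_cycle0 (u : 'rV[int]_#|cliques 0|) : boundary (row_chain u) = 0.
Proof.
apply/ffunP=> y; rewrite !ffunE big1 // => v vy.
have [->|/row_chain_neq0[_]] := eqVneq (row_chain u (v |: y)) 0; first by rewrite mulr0.
by rewrite cardsU1 vy.
Qed.

Variables (d : nat) (z : chain).
Hypothesis Gd : clique_number G = d.+1.
Hypothesis zF : fundamental_cycle le d.+1 [set: G] z.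

Lemma chain_row_small j : (j <= d)%N -> chain_row j z = 0.
Proof.
move=> jd; apply/rowP=> i; rewrite !mxE; apply/eqP; apply/negPn/negP=> zi.
have [_ zn _ _ _] := zF; have [_ ij] := enum_cliqueP i.
by have := zn _ zi; rewrite ij => jE; rewrite jE ltnn in jd.
Qed.

Lemma chain_rowMz j (f : chain) (c : int) : chain_row j (f *~ c) = chain_row j f *~ c.
Proof. by apply/rowP=> i; rewrite mxE ffunMzE -scaler_int !mxE -mulrzl. Qed.

Lemma chain_rowD j (f g : chain) : chain_row j (f + g) = chain_row j f + chain_row j g.
Proof. by apply/rowP=> i; rewrite !mxE ffunE. Qed.

(** Homology is generated by z, which has no component on sets of at most d vertices. *)
Lemma cycle_row_exact j (u : 'rV[int]_#|cliques j|) : (j <= d)%N ->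
  boundary (row_chain u) = 0 -> exists g, u = g *m boundary_mx j.
Proof.
move=> jd u0; have [_ _ _ zgen _] := zF.
have [c [g gS uE]] := zgen _ (supported_row_chain (u := u)) u0.
exists (chain_row j.+1 g); rewrite -chain_row_boundary //.
by rewrite -[LHS]row_chainK uE chain_rowD chain_rowMz chain_row_small // mul0rz add0r.
Qed.

Lemma top_boundary0 (g : chain) (x : {set G}) : supported [set: G] g -> #|x| = d.+1 -> boundary g x = 0.
Proof.
move=> gS xd; rewrite ffunE big1 // => v vx.
have [->|/gS/andP[vC _]] := eqVneq (g (v |: x)) 0; first by rewrite mulr0.
by have := leq_clique_number vC; rewrite cardsU1 vx xd Gd ltnn.
Qed.

Hypothesis Gu : unimodular_cycles d [set: G].

(** The common absolute value m is nonzero, as no nonzero multiple of z bounds. Then z = m w for a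
    cycle w, and w = c z up to a boundary; boundaries vanish on top simplices, so c m = 1. *)
Lemma fundamental_cycle_unit (x : {set G}) : clique x -> #|x| = d.+1 -> z x * z x = 1.
Proof.
move=> xC xd; have [zS zn z0 zgen znz] := zF.
have zsc : signed_cycle d [set: G] z.
  move=> r rC _ rd; exists (fun v => odd (position le r v)).
  have zr : \sum_(v | v \notin r) sgn v r * z (v |: r) = 0.
    by have := congr1 (fun f : chain => f r) z0; rewrite !ffunE.
  rewrite -[RHS]zr [RHS](bigID (fun v => clique (v |: r))) /= [X in _ = _ + X]big1 ?addr0.
    by apply: eq_big => [v|v _]; rewrite ?inE // signr_odd.
  move=> v /andP[_ vC]; have [->|/zS/andP[vC' _]] := eqVneq (z (v |: r)) 0.
    by rewrite mulr0.
  by rewrite vC' in vC.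
have [m mE] := Gu zsc.
have zm y : clique y -> #|y| = d.+1 -> `|z y| = m by move=> yC; apply: mE => //; rewrite subsetT.
have m0 : m != 0.
  apply/eqP=> m0; suff zz : z = 0.
    have := znz 1 0 (@supported0 G _); rewrite zz mul0rz raddf0 => /(_ erefl) /eqP.
    by rewrite oner_eq0.
  apply/ffunP=> y; rewrite [RHS]ffunE; apply/eqP; apply/negPn/negP=> zy.
  have /andP[yC _] := zS y zy; have := zy.
  by rewrite -normr_eq0 (zm y yC (zn y zy)) m0 eqxx.
pose w : chain := [ffun y : {set G} => Num.sg (z y)].
have wE : z = w *~ m.
  apply/ffunP=> y; rewrite ffunMzE ffunE -mulrzr intz.
  have [->|zy] := eqVneq (z y) 0; first by rewrite sgr0 mul0r.
  by have /andP[yC _] := zS y zy; rewrite -(zm y yC (zn y zy)) -numEsg.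
have wS : supported [set: G] w by move=> y; rewrite ffunE sgr_eq0; apply: zS.
have w0 : boundary w = 0.
  apply/ffunP=> y; have := congr1 (fun f : chain => f y) z0.
  rewrite wE raddfMz ffunMzE !ffunE -mulrzr intz => /eqP.
  by rewrite mulf_eq0 (negbTE m0) orbF => /eqP.
have [c [g gS wE']] := zgen w wS w0.
have zx : z x != 0 by rewrite -normr_eq0 zm.
have zxE : z x = w x * m by rewrite {1}wE ffunMzE -mulrzr intz.
have wx0 : w x != 0 by rewrite ffunE sgr_eq0.
have mc : c * m = 1.
  have := congr1 (fun f : chain => f x) wE'.
  rewrite [RHS]ffunE ffunMzE top_boundary0 // addr0 -mulrzr intz zxE => wmc.
  by apply: (mulfI wx0); rewrite mulr1 [c * m]mulrC mulrA -wmc.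
have ww : w x * w x = 1 by rewrite ffunE -expr2 sqr_sg zx.
rewrite zxE mulrACA ww mul1r.
by have /orP[] := intUnitRing.unitzPl mc => /eqP->.
Qed.

Lemma boundary_mx0_gram (i k : 'I_#|cliques 0|) :
  ((boundary_mx 0)^T *m boundary_mx 0) i k = #|simplices G 0|%:R.
Proof.
have M1 (a : 'I_#|cliques 1|) (b : 'I_#|cliques 0|) : boundary_mx 0 a b = 1.
  have [_ /cards0_eq b0] := enum_cliqueP b.
  have [_ /eqP/cards1P[v aE]] := enum_cliqueP a.
  rewrite mxE b0 aE /incidence_int (bigD1 v) /=; last by rewrite set11 setDv eqxx.
  rewrite big1 ?addr0 => [|u /andP[/andP[/set1P-> _]]]; last by rewrite eqxx.
  rewrite /sgn (_ : position le [set v] v = 0%N) ?expr0 //.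
  by apply: eq_card0 => u; rewrite !inE; case: (u == v).
rewrite mxE; under eq_bigr do rewrite mxE !M1 mulr1.
by rewrite sumr_const card_ord.
Qed.

Lemma card_cliques0 : #|cliques 0| = 1%N.
Proof.
rewrite -[RHS](cards1 (set0 : {set G})); apply: eq_card => s.
by rewrite !inE cards_eq0; case: eqP => [->|_]; rewrite ?clique0 ?andbF.
Qed.

(* [t j] is the squared covolume of the row lattice of [boundary_mx j]; the row
   lattice beyond the last matrix is spanned by the fundamental cycle. *)
Lemma boundary_gram_factors : exists t : nat -> int,
  [/\ forall j, (j <= d)%N ->
        exists r (U : 'M[int]_(_, r)) (V : 'M[int]_(r, _)),
          [/\ boundary_mx j = U *m V, \det (U^T *m U) = t j.+1,
              \det (V *m V^T) = t j, t j != 0 & t j.+1 != 0],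
      t 0%N = 1 & t d.+1 = #|simplices G d|%:R].
Proof.
have [zS zn z0 zgen znz] := zF.
have ex0 (u : 'rV_#|cliques 0|) : exists g, u = g *m boundary_mx 0.
  by apply: cycle_row_exact => //; apply: row_chain_cycle0.
have exS j : (j < d)%N -> forall u : 'rV_#|cliques j.+1|, u *m boundary_mx j = 0 ->
    exists g, u = g *m boundary_mx j.+1.
  by move=> jd u u0; apply: cycle_row_exact => //; apply: row_chain_cycle.
have [t [t0 [tE tlast]]] := exact_gram_factors boundary_mx_comp ex0 exS (leqnn d).
exists t; split=> //.
pose Z := chain_row d.+1 z.
have ZZ (i : 'I_#|cliques d.+1|) : Z 0 i * Z 0 i = 1.
  by have [iC id] := enum_cliqueP i; rewrite mxE; apply: fundamental_cycle_unit.
have [s sS] : exists s, s \in simplices G d by apply/card_gt0P; rewrite simplices_gt0 Gd.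
pose i0 : 'I_#|cliques d.+1| := enum_rank_in sS s.
(* The entries of Z are units, so a single coordinate provides a right inverse. *)
pose Q : 'cV[int]_#|cliques d.+1| := \col_i (Z 0 i *+ (i == i0)).
rewrite -(tlast 1%N Z Q).
- rewrite -[RHS]mul1r det_mx11 mxE; under eq_bigr do rewrite [Z^T _ _]mxE ZZ.
  by rewrite sumr_const card_ord mul1r.
- apply/matrixP=> i k; rewrite !ord1 [LHS]mxE (bigD1 i0) //= big1 ?addr0 => [|j ji].
    by rewrite [Q _ _]mxE eqxx mulr1n ZZ !mxE.
  by rewrite [Q _ _]mxE (negbTE ji) mulr0.
- by rewrite -chain_row_boundary // z0; apply/rowP=> i; rewrite !mxE ffunE.
move=> k A AM; apply: lift_rows => i.
have u0 : row i A *m boundary_mx d = 0 by rewrite -row_mul AM row0.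
have [c [g gS uE]] := zgen _ (supported_row_chain (u := row i A)) (row_chain_cycle u0).
exists c%:M; rewrite mul_scalar_mx -[LHS]row_chainK uE chain_rowD chain_rowMz.
rewrite [X in _ + X](_ : _ = 0) ?addr0 -?scaler_int ?intz //.
by apply/rowP=> l; have [_ ld] := enum_cliqueP l; rewrite !mxE top_boundary0.
Qed.
End BoundaryMatrices.

(** * Pseudo determinants and analytic torsion *)

Section CharPoly.
Variable K : comNzRingType.

Lemma char_poly_mx0 n : char_poly (0 : 'M[K]_n) = 'X^n.
Proof. by rewrite /char_poly /char_poly_mx map_mx0 subr0 det_scalar. Qed.

(** Since P Q = 0, the product (X - P)(X - Q) equals (X - (P + Q)) X. *)
Lemma char_polyD_orth n (P Q : 'M[K]_n) : P *m Q = 0 ->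
  char_poly (P + Q) * 'X^n = char_poly P * char_poly Q.
Proof.
move=> PQ; rewrite /char_poly -det_mulmx -(det_scalar n 'X) -det_mulmx.
congr (\det _); rewrite /char_poly_mx map_mxD /= !mulmxBl [in RHS]mulmxBr mulmxDl.
rewrite mulmxBr -map_mxM PQ map_mx0 subr0 opprD addrA addrAC.
by rewrite (scalar_mxC 'X (map_mx polyC Q)).
Qed.

(** Sylvester's identity: both sides are 'X^n times the determinant of the block matrix [C], made
    triangular in two ways. *)
Lemma char_poly_mulC m n (A : 'M[K]_(m, n)) (B : 'M[K]_(n, m)) :
  char_poly (A *m B) * 'X^n = char_poly (B *m A) * 'X^m.
Proof.
pose Ap := map_mx polyC A; pose Bp := map_mx polyC B.
pose C := block_mx ('X%:M : 'M[{poly K}]_m) Ap Bp (1%:M : 'M[_]_n).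
have d1 : \det C = char_poly (A *m B).
  have := det_mulmx (block_mx 1%:M (- Ap) 0 (1%:M : 'M[_]_n)) C.
  rewrite det_ublock !det1 !mul1r => <-; rewrite mulmx_block !mul1mx !mul0mx !add0r.
  by rewrite mulmx1 subrr det_lblock det1 mulr1 mulNmx -map_mxM.
rewrite -d1 mulrC -det_scalar.
have -> : \det ('X%:M : 'M[{poly K}]_n) =
          \det (block_mx (1%:M : 'M[_]_m) 0 (- Bp) ('X%:M : 'M[{poly K}]_n)).
  by rewrite det_lblock det1 mul1r.
rewrite -det_mulmx mulmx_block !mul1mx !mul0mx !addr0 mulmx1.
rewrite mulNmx -scalar_mxC addNr det_ublock det_scalar mulrC addrC mulNmx -map_mxM.
by [].
Qed.
End CharPoly.

Section NonzeroRoots.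
Variable F : fieldType.
Implicit Types s t : seq F.

Definition nonzero_prod s : F := \prod_(z <- s | z != 0) z.

Definition root_prod s : {poly F} := \prod_(z <- s) ('X - z%:P).

Lemma root_prod_cat s t : root_prod (s ++ t) = root_prod s * root_prod t.
Proof. exact: big_cat. Qed.

Lemma root_prod_nseq0 n : root_prod (nseq n 0) = 'X^n.
Proof. by rewrite /root_prod big_nseq subr0 iter_mulr_1. Qed.

Lemma nonzero_prod_cat s t : nonzero_prod (s ++ t) = nonzero_prod s * nonzero_prod t.
Proof. exact: big_cat. Qed.

Lemma nonzero_prod_nseq0 n : nonzero_prod (nseq n 0) = 1.
Proof. by apply: big1_seq => z; rewrite mem_nseq => /and3P[/negbTE->]. Qed.

(** Factors 'X adjoin only zero roots, so characteristic polynomials need to be compared only up to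
    powers of 'X. *)
Lemma nonzero_prod_eq s t a b :
  root_prod s * 'X^a = root_prod t * 'X^b -> nonzero_prod s = nonzero_prod t.
Proof.
rewrite -!root_prod_nseq0 -!root_prod_cat => /prod_XsubC_eq st.
rewrite -[LHS]mulr1 -(nonzero_prod_nseq0 a) -nonzero_prod_cat.
rewrite -[RHS]mulr1 -(nonzero_prod_nseq0 b) -nonzero_prod_cat.
exact: perm_big.
Qed.

End NonzeroRoots.
From mathcomp Require Import all_classical all_reals all_analysis complex.

Import Order.TTheory GRing.Theory Num.Theory.
Import numFieldNormedType.Exports.

Section PseudoDet.
Variable R : realType.
Local Notation C := (R[i]).

Lemma spectrumE n (M : 'M[R]_n) :
  root_prod (spectrum M) = char_poly (map_mx (real_complex R) M).
Proof.
rewrite /spectrum /root_prod; case: closed_field_poly_normal => s /= sE.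
by rewrite [RHS]sE (monicP (char_poly_monic _)) scale1r.
Qed.

Lemma nonzero_prodD_orth n (P Q : 'M[R]_n) : P *m Q = 0 ->
  nonzero_prod (spectrum (P + Q)) = nonzero_prod (spectrum P) * nonzero_prod (spectrum Q).
Proof.
move=> PQ; rewrite -nonzero_prod_cat.
have PQ' : map_mx (real_complex R) P *m map_mx (real_complex R) Q = 0.
  by rewrite -map_mxM PQ map_mx0.
apply: (@nonzero_prod_eq _ _ _ n 0); rewrite root_prod_cat expr0 mulr1.
transitivity (char_poly (map_mx (real_complex R) (P + Q)) * 'X^n).
  by congr (_ * _); apply: spectrumE.
rewrite map_mxD (char_polyD_orth PQ').
by congr (_ * _); apply/esym/spectrumE.
Qed.

Lemma nonzero_prod_mulC m n (A : 'M[R]_(m, n)) (B : 'M[R]_(n, m)) :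
  nonzero_prod (spectrum (A *m B)) = nonzero_prod (spectrum (B *m A)).
Proof.
apply: (@nonzero_prod_eq _ _ _ n m).
by rewrite !spectrumE !map_mxM char_poly_mulC.
Qed.

Lemma nonzero_prod0 n : nonzero_prod (spectrum (0 : 'M[R]_n)) = 1.
Proof.
rewrite -(nonzero_prod_nseq0 _ 0); apply: (@nonzero_prod_eq _ _ _ 0 n).
by rewrite spectrumE map_mx0 char_poly_mx0 root_prod_nseq0 mulrC.
Qed.

Lemma nonzero_prod_det n (M : 'M[R]_n) : \det M != 0 ->
  nonzero_prod (spectrum M) = (\det M)%:C%C.
Proof.
move=> dM; have := spectrumE M; set s := spectrum M; rewrite /root_prod => sE.
have szs : size s = n.
  have := congr1 (fun p : {poly C} => size p) sE.
  by rewrite (size_prod_XsubC s id) size_char_poly => -[].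
have pE : \prod_(z <- s) z = (\det M)%:C%C.
  have := congr1 (fun p : {poly C} => p.[0]) sE.
  rewrite [in RHS]horner_coef0 char_poly_det det_map_mx horner_prod.
  under eq_bigr do rewrite hornerXsubC sub0r.
  rewrite -[X in X = _](_ : (-1) ^+ n * \prod_(z <- s) z = _).
    by move/(mulfI _) => -> //; rewrite signr_eq0.
  under [in RHS]eq_bigr do rewrite -mulN1r.
  by rewrite big_split /= big_const_seq count_predT iter_mulr_1 szs.
rewrite /nonzero_prod -pE [RHS](bigID (fun z => z != 0)) /= [X in _ * X]big1_seq ?mulr1 //.
move=> z /andP[/negPn/eqP z0 zs]; have : \prod_(z <- s) z == 0.
  by rewrite prodf_seq_eq0; apply/hasP; exists z => //=; apply/eqP.
by rewrite pE fmorph_eq0 (negbTE dM).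
Qed.

(** The nonzero eigenvalues of V^T U^T U V are those of the invertible r by r matrix (U^T U)(V V^T),
    for which the product is the determinant. *)
Lemma nonzero_prod_gram m n r (U : 'M[R]_(m, r)) (V : 'M[R]_(r, n)) :
  \det (U^T *m U) != 0 -> \det (V *m V^T) != 0 ->
  nonzero_prod (spectrum ((U *m V)^T *m (U *m V))) =
  (\det (U^T *m U) * \det (V *m V^T))%:C%C.
Proof.
move=> dU dV; rewrite trmx_mul -!mulmxA nonzero_prod_mulC !mulmxA -!mulmxA.
by rewrite mulmxA nonzero_prod_det -?det_mulmx // det_mulmx mulf_neq0.
Qed.

Lemma nonzero_prod_tr m n (A : 'M[R]_(m, n)) :
  nonzero_prod (spectrum (A *m A^T)) = nonzero_prod (spectrum (A^T *m A)).
Proof. exact: nonzero_prod_mulC. Qed.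
End PseudoDet.

(** The factor E k occurs in p k and p k.+1, and its exponents k(-1)^(k+1) and (k+1)(-1)^(k+2) add
    up to (-1)^k. As E k = T k.+1 * T k.+2 for k < d, the remaining product telescopes to the end
    values of T. *)
Lemma torsion_telescope (F : fieldType) (T p : nat -> F) d :
  (forall j, (j <= d.+1)%N -> T j != 0) ->
  (forall k, (k < d)%N ->
     p k.+1 = (if (k.+1 < d)%N then T k.+2 * T k.+3 else 1) * (T k.+1 * T k.+2)) ->
  \prod_(k < d.+1) p k ^ (k%:Z * (-1) ^+ k.+1) = T 1%N * T d.+1 ^ ((-1) ^+ d.+1).
Proof.
move=> T0 pE.
pose E k := if (k < d)%N then T k.+1 * T k.+2 else 1.
have E0 k : E k != 0.
  rewrite /E; case: ifP => kd; last exact: oner_neq0.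
  by rewrite mulf_neq0 // T0 // ltnS // ltnW.
have step m : (m <= d)%N -> \prod_(k < m.+1) p k ^ (k%:Z * (-1) ^+ k.+1) =
    \prod_(k < m) E k ^ ((-1) ^+ k) * E m ^ (m%:Z * (-1) ^+ m.+1).
  elim: m => [_|m IH md].
    by rewrite big_ord_recl !big_ord0 !mul0r !expr0z !mulr1.
  rewrite big_ord_recr /= IH ?(ltnW md) // [in RHS]big_ord_recr /= -!mulrA.
  congr (_ * _); rewrite pE // -[if _ then _ else _]/(E m.+1).
  have -> : T m.+1 * T m.+2 = E m by rewrite /E md.
  rewrite exprzMl ?unitfE ?E0 // [E m.+1 ^ _ * _]mulrC mulrA; congr (_ * _).
  rewrite -expfzDr //; congr (_ ^ _); rewrite !exprS -[in X in _ + X]addn1 PoszD; ring.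
rewrite step // [X in _ * X](_ : _ = 1) ?mulr1; last by rewrite /E ltnn exp1rz.
suff tel m : (m <= d)%N ->
    \prod_(k < m) E k ^ ((-1) ^+ k) = T 1%N * T m.+1 ^ ((-1) ^+ m.+1) by apply: tel.
elim: m => [_|m IH md]; first by rewrite big_ord0 expr1 exprN1 mulfV ?T0.
rewrite big_ord_recr /= IH ?(ltnW md) // /E md -mulrA; congr (_ * _).
have Tm : T m.+1 != 0 by rewrite T0 // ltnS ltnW.
have Tm2 : T m.+2 != 0 by rewrite T0.
rewrite exprzMl ?unitfE ?Tm ?Tm2 // mulrA -expfzDr // exprS mulN1r addNr expr0z mul1r.
by rewrite !exprS mulrA mulrNN !mul1r.
Qed.

(** * The torsion in terms of simplex counts *)

Section TorsionFormula.
Variables (R : realType) (G : sgraph) (le : rel G).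
Hypothesis leL : linear_order le.

Lemma incidenceE (y x : {set G}) : incidence R le y x = (incidence_int le y x)%:~R.
Proof.
rewrite /incidence /incidence_int rmorph_sum /=; apply: eq_bigr => v _.
by rewrite rmorphXn rmorphN1.
Qed.

Lemma ext_derivE k : ext_deriv R le k = map_mx intr (boundary_mx le k.+1).
Proof. by apply/matrixP=> i j; rewrite !mxE incidenceE. Qed.

Lemma nonzero_prod_boundary k r (U : 'M[int]_(_, r)) (V : 'M[int]_(r, _)) :
  boundary_mx le k = U *m V -> \det (U^T *m U) != 0 -> \det (V *m V^T) != 0 ->
  let A : 'M[R]_(_, _) := map_mx intr (boundary_mx le k) in
  nonzero_prod (spectrum (A^T *m A)) =
  ((\det (U^T *m U))%:~R * (\det (V *m V^T))%:~R)%:C%C.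
Proof.
move=> ME dU dV A; have detE n (B : 'M[int]_n) : (\det B)%:~R = \det (map_mx intr B) :> R.
  by rewrite det_map_mx.
rewrite /A ME map_mxM !detE !map_mxM -!map_trmx; apply: nonzero_prod_gram.
  by rewrite map_trmx -map_mxM -detE intr_eq0.
by rewrite map_trmx -map_mxM -detE intr_eq0.
Qed.

Lemma squared_torsion_sphere d : clique_number G = d.+1 ->
  weak_sphere d.+1 [set: G] -> unimodular_cycles d [set: G] ->
  squared_torsion R le =
  #|simplices G 0|%:R * #|simplices G d|%:R ^ ((-1) ^+ d.+1).
Proof.
move=> Gd Gw Gu; have [z zF] := weak_sphere_fundamental_cycle leL Gw.
have [t [tE t0 td]] := boundary_gram_factors leL Gd zF Gu.
pose T j : R := (t j)%:~R.
pose A j : 'M[R]_(_, _) := map_mx intr (boundary_mx le j).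
pose D j := nonzero_prod (spectrum ((A j)^T *m A j)).
have DE j : (j <= d)%N -> D j = (T j.+1 * T j)%:C%C.
  move=> jd; have [r [U [V [ME dU dV tj tj1]]]] := tE j jd.
  by rewrite /D (nonzero_prod_boundary ME) ?dU ?dV.
have AA j : A j.+1 *m A j = 0 by rewrite -map_mxM boundary_mx_comp // map_mx0.
(* There are no simplices of dimension d.+1, so [A d.+1] has no rows. *)
have Dtop : D d.+1 = 1.
  rewrite /D; suff -> : (A d.+1)^T *m A d.+1 = 0 by apply: nonzero_prod0.
  have c0 : #|cliques G d.+2| = 0%N.
    apply/eqP; rewrite -leqn0 leqNgt -[#|cliques G d.+2|]/#|simplices G d.+1|.
    by rewrite simplices_gt0 Gd ltnn.
  apply/matrixP=> i j; rewrite !mxE big1 // => k _.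
  by have := ltn_ord k; rewrite [X in (_ < X)%N]c0.
(* One determinant computed twice: T 1 * T 0 with T 0 = 1 from the factorization, and f_0 from the 1
   by 1 Gram matrix of the augmentation. *)
have t1 : T 1%N = #|simplices G 0|%:R.
  have := DE 0%N (leq0n _); rewrite /T t0 mulr1 -/(T 1%N) => D0.
  have gE : \det ((A 0%N)^T *m A 0%N) = #|simplices G 0|%:R :> R.
    have det1c n (B : 'M[R]_n) b : n = 1%N -> (forall i j, B i j = b) -> \det B = b.
      by move=> n1; move: B; rewrite n1 => B BE; rewrite det_mx11 BE.
    apply: det1c => [|i j]; first exact: card_cliques0.
    rewrite /A map_trmx -map_mxM mxE boundary_mx0_gram //.
    by rewrite rmorph_nat.
  have g0 : \det ((A 0%N)^T *m A 0%N) != 0.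
    by rewrite gE pnatr_eq0 -lt0n simplices_gt0 Gd.
  apply: (fmorph_inj (real_complex R)); rewrite -[LHS]D0 /D.
  by rewrite nonzero_prod_det // gE.
have T0 j : (j <= d.+1)%N -> T j != 0.
  case: j => [|j] jd; first by rewrite /T t0 oner_neq0.
  by have [r [U [V [_ _ _ _ tj1]]]] := tE j jd; rewrite intr_eq0.
have pE k : (k < d)%N -> pseudo_det (form_laplacian R le k.+1) =
    (if (k.+1 < d)%N then T k.+2 * T k.+3 else 1) * (T k.+1 * T k.+2).
  move=> kd; rewrite /pseudo_det -/(nonzero_prod _) /form_laplacian !ext_derivE.
  rewrite -/(A k.+1) -/(A k.+2) nonzero_prodD_orth; last first.
    by rewrite mulmxA -[_ *m A k.+1]mulmxA AA mulmx0 mul0mx.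
  rewrite nonzero_prod_tr -/(D k.+2) -/(D k.+1) [D k.+1]DE //.
  have [kd'|kd'] := ltnP k.+1 d.
    by rewrite DE // -rmorphM /= [T k.+2 * T k.+3]mulrC [T k.+1 * _]mulrC.
  have -> : D k.+2 = 1.
    have kE : k.+1 = d by apply/eqP; rewrite eqn_leq kd kd'.
    by rewrite kE.
  by rewrite !mul1r mulrC.
rewrite /squared_torsion Gd (torsion_telescope (T := T)
  (p := fun k => pseudo_det (form_laplacian R le k))) //.
by rewrite t1; congr (_ * _ ^ _); rewrite /T td rmorph_nat.
Qed.
End TorsionFormula.

(** * The refinement operator and the limits *)

Section Operator.
Variable R : realType.

Definition barycentric_mx (d : nat) : 'M[R]_d :=
  \matrix_(i < d, j < d) (chain_count i j.+1)%:R.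

Lemma barycentric_mx_operator d : barycentric_operator (barycentric_mx d).
Proof.
move=> H Hd; apply/matrixP=> i j; rewrite !mxE (card_simplices_barycentric i Hd).
by rewrite natr_sum; apply: eq_bigr => k _; rewrite !mxE natrM.
Qed.

Lemma barycentric_mx_upper d (i j : 'I_d) : (j < i)%N -> barycentric_mx d i j = 0.
Proof. by move=> ji; rewrite mxE chain_count_small. Qed.

Lemma barycentric_mx_diag d (i : 'I_d) : barycentric_mx d i i = (i.+1`!)%:R.
Proof. by rewrite mxE chain_count_diag. Qed.

Definition complete_adj (m : nat) : rel 'I_m := fun x y => x != y.

Lemma complete_sym m : symmetric (@complete_adj m).
Proof. by move=> x y; rewrite /complete_adj eq_sym. Qed.

Lemma complete_irrefl m : irreflexive (@complete_adj m).
Proof. by move=> x; rewrite /complete_adj eqxx. Qed.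

Definition complete (m : nat) : sgraph := SGraph (@complete_sym m) (@complete_irrefl m).

Lemma clique_complete m (s : {set complete m}) : clique s.
Proof. by apply/cliqueP. Qed.

Lemma clique_number_complete m : (clique_number (complete m) <= m)%N.
Proof.
apply/bigmax_leqP => s _; apply: leq_trans (max_card _) _.
by rewrite card_ord.
Qed.

Lemma card_simplices_complete m k : #|simplices (complete m) k| = 'C(m, k.+1).
Proof.
have := card_draws 'I_m k.+1; rewrite card_ord => <-; apply: eq_card => s.
by rewrite !inE clique_complete.
Qed.

(* The f-vectors of the complete graphs K_1, ..., K_d form a unitriangular matrix. *)
Lemma barycentric_operator_unique d (B B' : 'M[R]_d) :
  barycentric_operator B -> barycentric_operator B' -> B = B'.
Proof.
move=> BO BO'; apply/eqP; rewrite -subr_eq0; apply/eqP; set D := B - B'.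
have D0 m : (m <= d)%N -> D *m fvector R d (complete m) = 0.
  move=> md; have Kd := leq_trans (clique_number_complete m) md.
  by rewrite mulmxBl (BO _ Kd) (BO' _ Kd) subrr.
apply/matrixP=> i j; rewrite [RHS]mxE.
have [n] := ubnP (j : nat); elim: n j => // n IH j jn.
have := congr1 (fun A : 'cV_d => A i 0) (D0 j.+1 (ltn_ord j)).
rewrite [RHS]mxE mxE (bigD1 j) //= big1 => [|k kj].
  by rewrite addr0 [fvector _ _ _ _ _]mxE card_simplices_complete binn mulr1.
rewrite [fvector _ _ _ _ _]mxE card_simplices_complete; case: (ltngtP k j) => [kltj|jltk|/val_inj kE].
- by rewrite IH ?mul0r // (leq_trans kltj).
- by rewrite bin_small ?mulr0.
- by rewrite kE eqxx in kj.
Qed.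

Lemma eigenvalue_barycentric_mx d a : eigenvalue (barycentric_mx d) a <->
  exists k, (1 <= k <= d)%N /\ a = (k`!)%:R.
Proof.
have cE : char_poly (barycentric_mx d) = \prod_(i < d) ('X - ((i.+1`!)%:R)%:P).
  (* [char_poly_trig] applies to lower triangular matrices, hence the transpose. *)
  have <- : char_poly (barycentric_mx d)^T = char_poly (barycentric_mx d).
    rewrite /char_poly -[RHS]det_tr; congr (\det _).
    by rewrite /char_poly_mx linearB /= tr_scalar_mx map_trmx.
  rewrite char_poly_trig; last first.
    by apply/is_trig_mxP => i j ij; rewrite mxE barycentric_mx_upper.
  by apply: eq_bigr => i _; rewrite mxE barycentric_mx_diag.
rewrite eigenvalue_root_char cE.
rewrite -(big_map (fun i : 'I_d => (i.+1`!)%:R) predT (fun z => 'X - z%:P)).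
rewrite root_prod_XsubC; split=> [/mapP[i _ ->]|[[|k] [kd ->]] //].
  by exists i.+1; rewrite ltn_ord.
by apply/mapP; exists (Ordinal kd); rewrite ?mem_index_enum.
Qed.

End Operator.

(** * Limits of triangular iterations *)

Section Asymptotics.
Variable R : realType.
Local Open Scope classical_set_scope.

Lemma contraction_cvg0 (u e : nat -> R) (q : R) : 0 <= q < 1 ->
  (forall n, u n.+1 = q * u n + e n) -> e @ \oo --> (0 : R) -> u @ \oo --> (0 : R).
Proof.
move=> /andP[q0 q1] uE e0; apply/cvgr0Pnorm_le => eps eps0.
(* With this threshold the bound eps/2 reproduces itself: q eps/2 + (1 - q) eps/2 = eps/2. *)
have d0 : 0 < eps / 2 * (1 - q) by rewrite mulr_gt0 ?divr_gt0 ?subr_gt0.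
have [N _ Ne] := (cvgr0Pnorm_le _).1 e0 _ d0.
have uN m : `|u (N + m)%N| <= eps / 2 + q ^+ m * `|u N|.
  elim: m => [|m IH].
    by rewrite addn0 expr0 mul1r lerDr divr_ge0 // ltW.
  rewrite addnS uE; apply: le_trans (ler_normD _ _) _.
  rewrite normrM (ger0_norm q0).
  apply: le_trans (lerD (ler_wpM2l q0 IH) (Ne _ (leq_addr m N))) _.
  by rewrite exprS; lra.
have qm : (fun m => q ^+ m * `|u N|) @ \oo --> (0 : R).
  rewrite -[0](mul0r `|u N|); apply: cvgMr_tmp.
  by apply: cvg_expr; rewrite ger0_norm.
have e2 : 0 < eps / 2 by rewrite divr_gt0.
have [M _ Mq] := (cvgr0Pnorm_le _).1 qm _ e2.
exists (N + M)%N => // n /= NMn.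
have Nn : (N <= n)%N := leq_trans (leq_addr M N) NMn.
rewrite -(subnKC Nn); apply: le_trans (uN _) _.
have Mn : (M <= n - N)%N by rewrite leq_subRL.
have := Mq _ Mn; rewrite /= ger0_norm; first by lra.
by rewrite mulr_ge0 // exprn_ge0.
Qed.

(** Descending induction on the row: row i is a contraction of ratio B i i / lambda, perturbed by
    the rows of larger index, which already tend to 0. *)
Lemma upper_triangular_power_cvg0 N (B : 'M[R]_N.+1) (lambda : R) (h : nat -> 'cV[R]_N.+1) :
  0 < lambda ->
  (forall i j : 'I_N.+1, (j < i)%N -> B i j = 0) ->
  (forall i : 'I_N.+1, (i < N)%N -> 0 <= B i i < lambda) ->
  (forall n, h n.+1 = lambda^-1 *: (B *m h n)) ->
  (forall n, h n ord_max 0 = 0) ->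
  forall i, (fun n => h n i 0) @ \oo --> (0 : R).
Proof.
move=> l0 Bu Bd hS htop i.
have [m] := ubnP (N - i)%N; elim: m i => // m IH i im.
have [iN|iN] := eqVneq i ord_max.
  have -> : (fun n => h n i 0) = (fun=> 0) by apply/funext => n; rewrite iN htop.
  exact: cvg_cst.
have {}iN : (i < N)%N.
  by rewrite ltn_neqAle -ltnS ltn_ord andbT; apply: contra_neq iN => iN; apply: val_inj.
pose e n : R := \sum_(j < N.+1 | (i < j)%N) (lambda^-1 * B i j) * h n j 0.
have /andP[b0 bl] := Bd i iN.
apply: (@contraction_cvg0 _ e (lambda^-1 * B i i)).
- by rewrite mulr_ge0 ?invr_ge0 ?(ltW l0) //= mulrC ltr_pdivrMr // mul1r.
- move=> n; rewrite hS !mxE (bigD1 i) //= mulrDr mulrA; congr (_ + _).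
  rewrite mulr_sumr /e [RHS]big_mkcond [LHS]big_mkcond; apply: eq_bigr => j _ /=.
  case: (ltngtP j i) => [ji|ij|/val_inj ->]; last by rewrite eqxx.
    by rewrite Bu // mul0r mulr0 if_same.
  by rewrite ifT ?mulrA //; apply: contraTneq ij => ->; rewrite ltnn.
have FF : Filter (nbhs \oo : set_system nat) by exact: filter_filter.
have sum0 := @cvg_big R 'I_N.+1 +%R 0 (fun j => (i < j)%N) (@add_continuous R^o) nat \oo
  (index_enum 'I_N.+1) (fun j n => lambda^-1 * B i j * h n j 0) (fun=> 0) FF.
rewrite [X in _ -> _ --> X]big1 // in sum0; apply: sum0 => j ij.
have jm : (N - j < m)%N by apply: leq_trans (ltn_sub2l iN ij) _.
have := cvgMl_tmp (a := lambda^-1 * B i j) (IH j jm); rewrite mulr0; exact.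
Qed.

(* After dividing by lambda^n and subtracting a multiple of g, only the strictly
   smaller eigenvalues are left. *)
Lemma power_iteration_cvg N (B : 'M[R]_N.+1) (lambda : R) (g : 'cV[R]_N.+1)
    (x : nat -> 'cV[R]_N.+1) :
  0 < lambda ->
  (forall i j : 'I_N.+1, (j < i)%N -> B i j = 0) ->
  B ord_max ord_max = lambda ->
  (forall i : 'I_N.+1, (i < N)%N -> 0 <= B i i < lambda) ->
  g != 0 -> B *m g = lambda *: g ->
  (forall n, x n.+1 = B *m x n) -> x 0%N ord_max 0 != 0 ->
  forall i, (fun n => x n i 0 / x n ord_max 0) @ \oo --> g i 0 / g ord_max 0.
Proof.
move=> l0 Bu Bl Bd g0 Bg xS x0 i; have lneq0 := lt0r_neq0 l0.
have top (y : 'cV[R]_N.+1) : (B *m y) ord_max 0 = lambda * y ord_max 0.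
  rewrite mxE (bigD1 ord_max) //= Bl big1 ?addr0 // => j jN.
  rewrite Bu ?mul0r //= ltn_neqAle -ltnS ltn_ord andbT.
  by apply: contra_neq jN => jN; apply: val_inj.
(* As lambda differs from all other diagonal entries, back substitution from a vanishing last entry
   would give g = 0. *)
have gN : g ord_max 0 != 0.
  apply: contra_neq g0 => gN; apply/matrixP=> j k; rewrite ord1 [RHS]mxE {k}.
  have [m] := ubnP (N - j)%N; elim: m j => // m IH j jm.
  have [->//|jN] := eqVneq j ord_max.
  have {}jN : (j < N)%N.
    by rewrite ltn_neqAle -ltnS ltn_ord andbT; apply: contra_neq jN => jN; apply: val_inj.
  have := congr1 (fun A : 'cV_N.+1 => A j 0) Bg; rewrite mxE [RHS]mxE.
  rewrite (bigD1 j) //= big1 ?addr0 => [|k kj].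
    move=> /eqP; rewrite -subr_eq0 -mulrBl mulf_eq0 subr_eq0 => /orP[/eqP Bj|/eqP//].
    by have := Bd j jN; rewrite Bj ltxx andbF.
  case: (ltngtP k j) => [kltj|jltk|/val_inj kE].
  - by rewrite Bu ?mul0r.
  - by rewrite IH ?mulr0 //; apply: leq_trans (ltn_sub2l jN jltk) _.
  - by rewrite kE eqxx in kj.
have xN n : x n ord_max 0 = lambda ^+ n * x 0%N ord_max 0.
  by elim: n => [|n IH]; rewrite ?expr0 ?mul1r // xS top IH exprS mulrA.
(* This c makes the last entry of every [h n] vanish, because the last entry of [x n] is exactly
   lambda^n times its initial value. *)
pose c := x 0%N ord_max 0 / g ord_max 0.
pose h n : 'cV[R]_N.+1 := lambda ^- n *: x n - c *: g.
have h0 : (fun n => h n i 0) @ \oo --> (0 : R).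
  apply: (@upper_triangular_power_cvg0 N B lambda h) => // n.
    rewrite /h mulmxBr -!scalemxAr Bg scalerBr !scalerA xS; congr (_ *: _ - _ *: _).
      by rewrite exprS invfM.
    by field.
  rewrite !mxE xN mulrA mulVf ?expf_neq0 // mul1r /c -mulrA mulVf // mulr1.
  by rewrite subrr.
have -> : (fun n => x n i 0 / x n ord_max 0) =
          (fun n => g i 0 / g ord_max 0 + h n i 0 / x 0%N ord_max 0).
  apply/funext => n; rewrite !mxE xN /c.
  have ln : lambda ^+ n != 0 by rewrite expf_neq0.
  by field; rewrite ln x0 gN.
rewrite -[X in _ --> X]addr0; apply: cvgD; first exact: cvg_cst.
by have := cvgMr_tmp (b := (x 0%N ord_max 0)^-1) h0; rewrite mul0r; exact.
Qed.
End Asymptotics.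

(** What the torsion formula requires and refinement preserves; the sphere axioms themselves enter
    only for the initial graph. *)
Definition sphere_like (d : nat) (G : sgraph) : Prop :=
  [/\ clique_number G = d.+1, weak_sphere d.+1 [set: G]
    & unimodular_cycles d [set: G]].

Lemma graph_sphere_like d G : graph_sphere d G -> sphere_like d G.
Proof.
move=> /sphere_succ_set Gs; split.
- apply/eqP; rewrite eqn_leq; apply/andP; split.
    by apply/bigmax_leqP => s sC; apply: (sphere_set_dim Gs sC); apply: finset.subsetT.
  have [v vG] := sphere_set_neq0 Gs.
  by have [t [tC _ _ <-]] := sphere_set_pure Gs vG; apply: leq_clique_number.
- exact: sphere_set_weak.
- exact: sphere_set_unimodular.
Qed.

Lemma sphere_like_barycentric d G : sphere_like d G -> sphere_like d (barycentric G).
Proof.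
case=> Gd Gw Gu; split; first by rewrite clique_number_barycentric.
  exact: weak_sphere_barycentric.
by apply: unimodular_cycles_barycentric; rewrite ?Gd.
Qed.

Lemma sphere_like_iter d G n : sphere_like d G -> sphere_like d (barycentric_iter n G).
Proof. by move=> Gs; elim: n => //= n; apply: sphere_like_barycentric. Qed.

Local Open Scope classical_set_scope.

Theorem mainTheorem5 (R : realType) (G : sgraph)
    (ord : forall n : nat, rel (barycentric_iter n G))
    (hord : forall n : nat, linear_order (ord n)) :
  (forall r : nat, graph_sphere (2 * r) G ->
     (exists! B : 'M[R]_((2 * r).+1), barycentric_operator B) /\
     (forall B : 'M[R]_((2 * r).+1), barycentric_operator B ->
        [/\ forall n : nat,
              B *m fvector R (2 * r).+1 (barycentric_iter n G)
              = fvector R (2 * r).+1 (barycentric_iter n.+1 G),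
            forall i j : 'I_((2 * r).+1), (j < i)%N -> B i j = 0,
            forall a : R, eigenvalue B a <->
              exists k : nat, (1 <= k <= (2 * r).+1)%N /\ a = (k`!)%:R
          & forall g : 'cV[R]_((2 * r).+1),
              g != 0 -> B *m g = (((2 * r).+1)`!)%:R *: g ->
              (fun n : nat => squared_torsion R (ord n)) @ \oo
                --> g ord0 ord0 / g ord_max ord0])) /\
  (forall r : nat, graph_sphere (2 * r).+1 G ->
     (fun n : nat => squared_torsion R (ord n)) @ \oo --> +oo).
Proof.
split=> r /graph_sphere_like Gs; have Gn n := sphere_like_iter n Gs.
  have torsionE n : squared_torsion R (ord n) =
      #|simplices (barycentric_iter n G) 0|%:R / #|simplices (barycentric_iter n G) (2 * r)|%:R.
    have [Gd Gw Gu] := Gn n.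
    by rewrite (squared_torsion_sphere R (hord n) Gd Gw Gu) exprS exprM sqrrN expr1n mulr1 exprN1.
  split.
    exists (barycentric_mx R (2 * r).+1); split; first exact: barycentric_mx_operator.
    by move=> B BO; apply: barycentric_operator_unique BO; apply: barycentric_mx_operator.
  move=> B BO.
  have {BO} -> : B = barycentric_mx R (2 * r).+1.
    exact: barycentric_operator_unique BO (@barycentric_mx_operator _ _).
  have xS n : barycentric_mx R (2 * r).+1 *m fvector R (2 * r).+1 (barycentric_iter n G)
              = fvector R (2 * r).+1 (barycentric_iter n.+1 G).
    by apply: barycentric_mx_operator; have [->] := Gn n.
  split=> // [i j|a|g g0 gE].
  - exact: barycentric_mx_upper.
  - exact: eigenvalue_barycentric_mx.
  - have -> : (fun n => squared_torsion R (ord n)) = (fun n =>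
        fvector R (2 * r).+1 (barycentric_iter n G) ord0 0 /
        fvector R (2 * r).+1 (barycentric_iter n G) ord_max 0).
      by apply/funext => n; rewrite torsionE !mxE.
    apply: (power_iteration_cvg (lambda := (((2 * r).+1)`!)%:R) _ _ _ _ g0 gE) => //.
    + exact: barycentric_mx_upper.
    + by rewrite barycentric_mx_diag.
    + move=> i ir; rewrite barycentric_mx_diag ler0n ltr_nat /=.
      apply: leq_trans (leq_fact (_ : i.+2 <= (2 * r).+1)%N) => //.
      by rewrite [in ltnRHS]factS ltn_Pmull ?fact_gt0.
    + by rewrite mxE pnatr_eq0 -lt0n simplices_gt0; case: Gs => ->.
have torsionE n : squared_torsion R (ord n) = #|simplices (barycentric_iter n G) 0|%:R *
    #|simplices (barycentric_iter n G) (2 * r).+1|%:R.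
  have [Gd Gw Gu] := Gn n.
  by rewrite (squared_torsion_sphere R (hord n) Gd Gw Gu) 2!exprS mulrA mulrNN !mul1r exprM sqrrN expr1n expr1z.
(* Refinement multiplies the number of top simplices by (2r+2)! >= 2, so it grows at least linearly;
   A is at least this number since f_0 >= 1. *)
have top n : (n <= #|simplices (barycentric_iter n G) (2 * r).+1|)%N.
  elim: n => // n IH; have [Gd _ _] := Gn n.
  apply: (@leq_trans ((2 * r).+2`! * #|simplices (barycentric_iter n G) (2 * r).+1|)); last first.
    have nE := @card_simplices_barycentric (barycentric_iter n G) (2 * r).+1 (2 * r).+2.
    rewrite -chain_count_diag [leqRHS]nE ?Gd // big_ord_recr; exact: leq_addl.
  have g0 : (0 < #|simplices (barycentric_iter n G) (2 * r).+1|)%N by rewrite simplices_gt0 Gd.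
  apply: leq_ltn_trans IH _; apply: ltn_Pmull => //.
  by rewrite factS (leq_trans _ (leq_pmulr _ (fact_gt0 _))).
apply: (@ger_cvgy _ _ _ _ (fun n => n%:R : R)); last exact: cvgr_idn.
near=> n; rewrite torsionE -natrM ler_nat; apply: leq_trans (top n) _.
apply: leq_pmull; have [Gd _ _] := Gn n.
by rewrite simplices_gt0 Gd.
Unshelve. all: by end_near. Qed.
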